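(* Let $A$ be an $m \times n$ random matrix which follows either of the following two models: (row-independent model) the rows of $A$ are independent sub-gaussian isotropic random vectors in $\mathbb{R}^n$; (column-independent model) the columns $A_i$ of $A$ are independent sub-gaussian isotropic random vectors in $\mathbb{R}^m$ with $\|A_i\|_2 = \sqrt{m}$ almost surely. Then the normalized matrix $\bar{A} = \frac{1}{\sqrt{m}} A$ satisfies the following for every sparsity level $1 \le k \le n$ and every number $\delta \in (0,1)$: if $$m \ge C\delta^{-2} k \log(en/k),$$ then $\delta_k(\bar{A}) \le \delta$ with probability at least $1 - 2\exp(-c\delta^2 m)$. Here $C = C_K > 0$ and $c = c_K > 0$ depend only on the sub-gaussian norm $K = \max_i \|A_i\|_{\psi_2}$, the maximum being over the rows of $A$ in the row-independent model and over the columns of $A$ in the column-independent model.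
   Context: For an $m\times n$ matrix $B$ and $k \ge 1$, the restricted isometry constant $\delta_k(B)$ is the smallest number $\delta_k \ge 0$ such that $$(1-\delta_k)\|x\|_2^2 \le \|Bx\|_2^2 \le (1+\delta_k)\|x\|_2^2$$ for all $x \in \mathbb{R}^n$ with $|\mathrm{supp}(x)| \le k$, where $\mathrm{supp}(x)$ is the set of indices of nonzero coordinates of $x$. The number $k$ need not be an integer. A random vector $X$ in $\mathbb{R}^d$ is isotropic if $\mathbb{E}\, XX^T = I$, equivalently $\mathbb{E}\langle X,x\rangle^2 = \|x\|_2^2$ for all $x \in \mathbb{R}^d$ (no centering is assumed). The sub-gaussian norm of a random variable $Z$ is $\|Z\|_{\psi_2} = \sup_{p \ge 1} p^{-1/2} (\mathbb{E}|Z|^p)^{1/p}$, and $Z$ is sub-gaussian if this is finite. A random vector $X$ in $\mathbb{R}^d$ is sub-gaussian if $\langle X,x\rangle$ is sub-gaussian for every $x\in\mathbb{R}^d$, and $\|X\|_{\psi_2} = \sup_{x \in S^{d-1}} \|\langle X,x\rangle\|_{\psi_2}$, where $S^{d-1}$ is the unit Euclidean sphere. *)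

(* Defs.v *)
From HB Require Import structures.
From mathcomp Require Import all_boot all_order all_algebra.
From mathcomp Require Import all_classical all_reals all_analysis.

Set Implicit Arguments.
Unset Strict Implicit.
Unset Printing Implicit Defensive.

Import Order.TTheory GRing.Theory Num.Theory.
Import numFieldNormedType.Exports.

Local Open Scope classical_set_scope.
Local Open Scope ring_scope.

(* The library norm `|x| on matrices is the sup norm, hence the Euclidean
   structure is introduced here. *)
Definition dot {R : realType} {d : nat} (x y : 'cV[R]_d) : R :=
  \sum_(i < d) x i ord0 * y i ord0.

Definition l2norm {R : realType} {d : nat} (x : 'cV[R]_d) : R :=
  Num.sqrt (\sum_(i < d) x i ord0 ^+ 2).

Definition supp {R : realType} {d : nat} (x : 'cV[R]_d) : {set 'I_d} :=
  [set i | x i ord0 != 0]%SET.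

Definition ric_bound {R : realType} {m n : nat} (k : R) (B : 'M[R]_(m, n))
    (delta : R) : Prop :=
  forall x : 'cV[R]_n, #|supp x|%:R <= k ->
    (1 - delta) * l2norm x ^+ 2 <= l2norm (B *m x) ^+ 2 /\
    l2norm (B *m x) ^+ 2 <= (1 + delta) * l2norm x ^+ 2.

(* [ric_is_smallest] below shows that this infimum is attained. *)
Definition ric {R : realType} {m n : nat} (k : R) (B : 'M[R]_(m, n)) : R :=
  inf [set delta | 0 <= delta /\ ric_bound k B delta].

Section ric_theory.
Context {R : realType}.

Lemma l2norm_sqr d (x : 'cV[R]_d) :
  l2norm x ^+ 2 = \sum_(i < d) x i ord0 ^+ 2.
Proof. by rewrite /l2norm sqr_sqrtr// sumr_ge0// => i _; exact: sqr_ge0. Qed.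

Lemma l2norm_mulmx_le m n (B : 'M[R]_(m, n)) :
  exists2 M : R, 0 <= M &
    forall x : 'cV[R]_n, l2norm (B *m x) ^+ 2 <= M * l2norm x ^+ 2.
Proof.
exists (\sum_(i < m) (\sum_(j < n) `|B i j|) ^+ 2).
  by apply: sumr_ge0 => i _; exact: sqr_ge0.
move=> x; rewrite l2norm_sqr mulr_suml; apply: ler_sum => i _.
have xj j : `|x j ord0| <= l2norm x.
  rewrite -(ler_pXn2r (n := 2))// ?nnegrE ?sqrtr_ge0//.
  rewrite l2norm_sqr real_normK ?num_real// (bigD1 j)//= lerDl.
  by apply: sumr_ge0 => l _; exact: sqr_ge0.
rewrite -exprMn -real_normK ?num_real// ler_pXn2r ?nnegrE//; last first.
  by rewrite mulr_ge0 ?sqrtr_ge0 ?sumr_ge0.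
rewrite mxE mulr_suml (le_trans (ler_norm_sum _ _ _))//.
by apply: ler_sum => j _; rewrite normrM ler_wpM2l.
Qed.

Lemma ric_is_smallest m n (k : R) (B : 'M[R]_(m, n)) :
  [/\ 0 <= ric k B, ric_bound k B (ric k B) &
      forall delta, 0 <= delta -> ric_bound k B delta -> ric k B <= delta].
Proof.
set S := [set delta | 0 <= delta /\ ric_bound k B delta].
have lbS : lbound S 0 by move=> d [].
have S0 : S !=set0.
  have [M M0 BM] := l2norm_mulmx_le B.
  exists (1 + M); split; first by rewrite addr_ge0.
  move=> x _; have x0 := sqr_ge0 (l2norm x); split.
    rewrite (le_trans _ (sqr_ge0 _))// mulr_le0_ge0//.
    by rewrite opprD addrA subrr add0r oppr_le0.
  rewrite (le_trans (BM x))// ler_wpM2r// addrA lerDr.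
  by rewrite addr_ge0.
have hS : has_inf S by split=> //; exists 0.
split.
- exact: lb_le_inf.
- move=> x kx; have := sqr_ge0 (l2norm x); rewrite le_eqVlt => /predU1P[x0|x0].
    have [d [_ bd]] := S0.
    by have := bd x kx; rewrite -x0 !mulr0.
  split.
  + rewrite -ler_pdivlMr// lerBlDr -lerBlDl; apply: lb_le_inf => // d [_].
    move=> /(_ x kx)[+ _].
    by rewrite -ler_pdivlMr// lerBlDr lerBlDl addrC.
  + rewrite -ler_pdivrMr// -lerBlDl; apply: lb_le_inf => // d [_].
    by move=> /(_ x kx)[_]; rewrite -ler_pdivrMr// lerBlDl.
- by move=> d d0 bd; apply: ge_inf; [exists 0|split].
Qed.

Lemma ric_leP m n (k : R) (B : 'M[R]_(m, n)) (delta : R) : 0 <= delta ->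
  ric k B <= delta <-> ric_bound k B delta.
Proof.
move=> delta0; have [_ bB leB] := ric_is_smallest k B; split; last exact: leB.
move=> Bd x kx; have [h1 h2] := bB x kx; split.
- by rewrite (le_trans _ h1)// ler_wpM2r ?sqr_ge0// lerD2l lerN2.
- by rewrite (le_trans h2)// ler_wpM2r ?sqr_ge0// lerD2l.
Qed.

End ric_theory.

(* The sigma-algebra on R^d generated by the coordinate maps, i.e. the Borel
   one. *)
Definition borel_vec {R : realType} {d : nat} : set (set 'cV[R]_d) :=
  g_sigma_preimage (fun (i : 'I_d) (x : 'cV[R]_d) => x i ord0).

Section random_vectors.
Context {R : realType} {disp : measure_display} {Omega : measurableType disp}.
Context (P : probability Omega R).

Definition random_matrix {m n : nat} (A : Omega -> 'M[R]_(m, n)) : Prop :=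
  forall i j, measurable_fun [set: Omega] (fun w => A w i j).

Definition mutually_independent {N d : nat} (X : 'I_N -> Omega -> 'cV[R]_d) :
    Prop :=
  forall (J : {set 'I_N}) (B : 'I_N -> set 'cV[R]_d),
    (forall i, i \in J -> borel_vec (B i)) ->
    P (\bigcap_(i in [set` J]) (X i @^-1` B i)) =
    (\prod_(i in J) P (X i @^-1` B i))%E.

Definition isotropic {d : nat} (X : Omega -> 'cV[R]_d) : Prop :=
  forall i j : 'I_d,
    ('E_P[fun w => (X w i ord0 * X w j ord0)%R] =
     ((1%:M : 'M[R]_d) i j)%:E)%E.

Definition psi2norm (Z : Omega -> R) : \bar R :=
  ereal_sup [set ((p `^ (- 2^-1))%:E * 'N[P]_p%:E[EFin \o Z])%E
            | p in [set p : R | 1 <= p]].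

Definition subgaussian (Z : Omega -> R) : Prop := (psi2norm Z < +oo)%E.

Definition subgaussian_vec {d : nat} (X : Omega -> 'cV[R]_d) : Prop :=
  forall x : 'cV[R]_d, subgaussian (fun w => dot (X w) x).

Definition psi2norm_vec {d : nat} (X : Omega -> 'cV[R]_d) : \bar R :=
  ereal_sup [set psi2norm (fun w => dot (X w) x)
            | x in [set x : 'cV[R]_d | l2norm x = 1]].

Definition rand_row {m n : nat} (A : Omega -> 'M[R]_(m, n)) (i : 'I_m) :
  Omega -> 'cV[R]_n := fun w => (row i (A w))^T.

Definition rand_col {m n : nat} (A : Omega -> 'M[R]_(m, n)) (j : 'I_n) :
  Omega -> 'cV[R]_m := fun w => col j (A w).

Definition row_independent_model {m n : nat} (A : Omega -> 'M[R]_(m, n)) :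
    Prop :=
  [/\ random_matrix A, mutually_independent (rand_row A),
      forall i, subgaussian_vec (rand_row A i) &
      forall i, isotropic (rand_row A i)].

Definition column_independent_model {m n : nat} (A : Omega -> 'M[R]_(m, n)) :
    Prop :=
  [/\ random_matrix A, mutually_independent (rand_col A),
      forall j, subgaussian_vec (rand_col A j),
      forall j, isotropic (rand_col A j) &
      forall j, {ae P, forall w, l2norm (rand_col A j w) = Num.sqrt m%:R}].

Definition max_row_psi2norm {m n : nat} (A : Omega -> 'M[R]_(m, n)) : \bar R :=
  \big[maxe/-oo%E]_(i < m) psi2norm_vec (rand_row A i).

Definition max_col_psi2norm {m n : nat} (A : Omega -> 'M[R]_(m, n)) : \bar R :=
  \big[maxe/-oo%E]_(j < n) psi2norm_vec (rand_col A j).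

End random_vectors.

(* Main.v *)
(* Neither model needs decoupling, and the net needs no volume argument.

   A variable Z with psi_2-norm at most K satisfies E exp(a Z^2) <= 2 for
   a = 1/(4 e K^2).  From this, for every unit vector x and |t| <= 1/D with D
   depending on K only, one gets
     E exp(t (|A x|^2 - m)) <= exp(D m t^2 + |supp x|).              (1)
   For independent rows, |A x|^2 is a sum of independent variables and
   e^u <= 1 + u + u^2 e^|u| applies to each of them.  For independent columns,
   the partial sums S_l = sum_(j < l) x_j A_j satisfy
     |S_(l+1)|^2 = |S_l|^2 + 2 x_l <A_l, S_l> + m x_l^2,
   and given S_l the middle term has a moment generating function bounded by
   2 exp(C t^2 x_l^2 |S_l|^2), so that (1) follows from a supermartingale of the
   form exp(theta_l |S_l|^2 + const_l) with slowly varying theta_l.  The factor 2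
   is lost only when x_l <> 0, which costs at most exp(|supp x|); this is why no
   centering is required.

   By Markov's inequality |A x|^2 is within (delta/2) m |x|^2 of m |x|^2 up to
   probability 2 exp(|supp x| - c delta^2 m).  A union bound is taken over the
   integer vectors z with |supp z| <= k and sum |z_i| <= 4 k; weighting z by
   (k/n)^|supp z| 2^(- sum |z_i|) shows that there are at most
   exp(6 k + k log(n/k)) of them.  Rounding the coordinates of x towards zero on
   a suitable scale shows that they are a 1/4-net of all directions of k-sparse
   vectors, by a rounding that never enlarges the support. *)

Require Import Defs.
From HB Require Import structures.
From mathcomp Require Import all_boot all_order all_algebra.
From mathcomp Require Import all_classical all_reals all_analysis.
From mathcomp Require Import measurable_realfun ring lra.
Import Order.TTheory GRing.Theory Num.Theory.
Import numFieldNormedType.Exports.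
Set Implicit Arguments.
Unset Strict Implicit.
Unset Printing Implicit Defensive.
Local Open Scope classical_set_scope.
Local Open Scope ring_scope.

(** * Restricted isometry constants via rounding *)

Section rip_grid.
Context {R : realType}.

(** The quadratic form of [B^T B - I]. A restricted isometry bound is a bound on its absolute value
    over sparse vectors. *)
Definition defect {m n : nat} (B : 'M[R]_(m, n)) (x : 'cV[R]_n) : R :=
  l2norm (B *m x) ^+ 2 - l2norm x ^+ 2.

Lemma l2norm_lincomb n (a b : R) (x y : 'cV[R]_n) :
  l2norm (a *: x + b *: y) ^+ 2 =
  a ^+ 2 * l2norm x ^+ 2 + 2 * a * b * dot x y + b ^+ 2 * l2norm y ^+ 2.
Proof.
rewrite !l2norm_sqr /dot !mulr_sumr -!big_split /=.
by apply: eq_bigr => i _; rewrite !mxE; ring.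
Qed.

Lemma l2normZ n (a : R) (x : 'cV[R]_n) :
  l2norm (a *: x) ^+ 2 = a ^+ 2 * l2norm x ^+ 2.
Proof. by rewrite !l2norm_sqr mulr_sumr; apply: eq_bigr => i _; rewrite mxE exprMn. Qed.

Lemma defectZ m n (B : 'M[R]_(m, n)) (a : R) (x : 'cV[R]_n) :
  defect B (a *: x) = a ^+ 2 * defect B x.
Proof. by rewrite /defect -scalemxAr !l2normZ mulrBr. Qed.

Lemma ric_boundP m n (k : R) (B : 'M[R]_(m, n)) (delta : R) :
  ric_bound k B delta <->
  forall x : 'cV[R]_n, #|supp x|%:R <= k -> `|defect B x| <= delta * l2norm x ^+ 2.
Proof.
rewrite /defect; split=> H x kx.
  by have [h1 h2] := H x kx; rewrite ler_norml; apply/andP; split; lra.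
by have := H x kx; rewrite ler_norml => /andP[h1 h2]; split; lra.
Qed.

(* With [a = (t + t^-1)/2] and [b = (t^-1 - t)/2] one has [a^2 - b^2 = 1], so
   the quadratic form [defect] satisfies
   Q(x) - Q(y) = Q(a x + b y) - Q(b x + a y). *)
Lemma defect_sub_le m n (k t M : R) (B : 'M[R]_(m, n)) (x y : 'cV[R]_n) :
  t != 0 -> ric_bound k B M -> #|supp x|%:R <= k ->
  (forall i, x i ord0 = 0 -> y i ord0 = 0) ->
  `|defect B x - defect B y| <=
  M / 2 * (t ^+ 2 * l2norm (x - y) ^+ 2 + t ^- 2 * l2norm (x + y) ^+ 2).
Proof.
move=> t0 /ric_boundP BM kx xy.
pose a := (t + t^-1) / 2; pose b := (t^-1 - t) / 2.
(* The support of [y] lies in that of [x], so both combinations stay [k]-sparse and [BM] applies to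
   them. *)
have sparse c e : #|supp (c *: x + e *: y)|%:R <= k.
  apply: le_trans kx; rewrite ler_nat subset_leq_card//.
  apply/fintype.subsetP => i; rewrite !inE !mxE; apply: contra_neq => xi.
  by rewrite xi (xy _ xi) !mulr0 addr0.
have E : defect B x - defect B y =
    defect B (a *: x + b *: y) - defect B (b *: x + a *: y).
  rewrite /defect !mulmxDr -!scalemxAr !l2norm_lincomb /a /b.
  by field.
(* The two vectors are [(x + y) / (2 t) + t (x - y) / 2] and [(x + y) / (2 t) - t (x - y) / 2]; this
   is the parallelogram law. *)
have F : l2norm (a *: x + b *: y) ^+ 2 + l2norm (b *: x + a *: y) ^+ 2 =
    (t ^+ 2 * l2norm (x - y) ^+ 2 + t ^- 2 * l2norm (x + y) ^+ 2) / 2.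
  have -> : x - y = 1 *: x + (-1) *: y by rewrite scale1r scaleN1r.
  have -> : x + y = 1 *: x + 1 *: y by rewrite !scale1r.
  by rewrite !l2norm_lincomb /a /b; field.
rewrite E -mulrA [2^-1 * _]mulrC -F mulrDr.
apply: le_trans (ler_normB _ _) _; apply: lerD; exact: BM (sparse _ _).
Qed.

(** A self-bounding argument: the error of passing from [x] to [y] is measured by the constant [M]
    itself, so [delta + 2 M / q] is admissible and minimality of [M] gives the inequality. *)
Lemma ric_le_of_approx m n (k delta : R) (B : 'M[R]_(m, n)) (q : nat) :
  (0 < q)%N -> 0 <= delta ->
  (forall x : 'cV[R]_n, x != 0 -> #|supp x|%:R <= k -> exists y : 'cV[R]_n,
    [/\ forall i, x i ord0 = 0 -> y i ord0 = 0,
        l2norm y ^+ 2 <= l2norm x ^+ 2,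
        l2norm (x - y) ^+ 2 <= l2norm x ^+ 2 / q%:R ^+ 2 &
        `|defect B y| <= delta * l2norm y ^+ 2]) ->
  ric k B <= delta + 2 / q%:R * ric k B.
Proof.
move=> q0 delta0 H; have [M0 BM minM] := ric_is_smallest k B.
set M := ric k B in M0 BM minM *.
have qR : 0 < q%:R :> R by rewrite ltr0n.
apply: minM; first by rewrite addr_ge0// mulr_ge0// divr_ge0// ltW.
apply/ric_boundP => x kx; have [->|x0] := eqVneq x 0.
  have -> : (0 : 'cV[R]_n) = 0 *: 0 by rewrite scale0r.
  by rewrite defectZ l2normZ expr0n /= !mul0r normr0 mulr0.
have [y [xy yx dxy Qy]] := H x x0 kx.
set X := l2norm x ^+ 2 in yx dxy *; have X0 : 0 <= X by exact: sqr_ge0.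
(* This [t] balances the two terms of [defect_sub_le]: with [|x - y|^2 <= X / q^2] and
   [|x + y|^2 <= 4 X], each is at most [2 X / q]. *)
pose t := Num.sqrt (2 * q%:R : R).
have t2 : t ^+ 2 = 2 * q%:R by rewrite sqr_sqrtr// mulr_ge0// ltW.
have t0 : t != 0 by rewrite -sqrf_eq0 t2 mulf_neq0 ?gt_eqF.
have S : l2norm (x + y) ^+ 2 <= 4 * X.
  have h1 : l2norm (x + y) ^+ 2 = X + 2 * dot x y + l2norm y ^+ 2.
    have -> : x + y = 1 *: x + 1 *: y by rewrite !scale1r.
    by rewrite l2norm_lincomb /X; ring.
  have h2 : l2norm (x - y) ^+ 2 = X - 2 * dot x y + l2norm y ^+ 2.
    have -> : x - y = 1 *: x + (-1) *: y by rewrite scale1r scaleN1r.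
    by rewrite l2norm_lincomb /X; ring.
  by have := sqr_ge0 (l2norm (x - y)); lra.
have := defect_sub_le t0 BM kx xy; rewrite t2 => D.
have {D} D : `|defect B x - defect B y| <= 2 / q%:R * M * X.
  apply: le_trans D _.
  have -> : 2 / q%:R * M * X = M / 2 * (2 * q%:R * (X / q%:R ^+ 2) + (2 * q%:R)^-1 * (4 * X)).
    by field; rewrite gt_eqF.
  rewrite ler_wpM2l ?divr_ge0//; apply: lerD.
    by rewrite ler_wpM2l ?mulr_ge0// ltW.
  by rewrite ler_wpM2l ?invr_ge0 ?mulr_ge0// ltW.
have -> : defect B x = (defect B x - defect B y) + defect B y by rewrite subrK.
rewrite mulrDl addrC; apply: le_trans (ler_normD _ _) _; apply: lerD => //.
by apply: le_trans Qy _; rewrite ler_wpM2l.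
Qed.

(** * Rounding to integer vectors *)

Definition grid_vec {n} (z : 'I_n -> int) : 'cV[R]_n := \col_i (z i)%:~R.

(** Rounding towards zero never increases the absolute value, so zeros stay zeros. That bound is
    stated twice: in [nat] for the sum of the [|z_i|], in [R] for the norm. *)
Lemma trunc_toward_zero (r : R) : exists z : int,
  [/\ `|z|%N%:R <= `|r|, `|r - z%:~R| <= 1 & `|z%:~R| <= `|r|].
Proof.
have H (s : R) : 0 <= s -> ((Num.truncn s)%:R <= s) /\ (s < (Num.truncn s)%:R + 1).
  move=> s0; split; first by rewrite truncn_le.
  by have := truncnS_gt s; rewrite -addn1 natrD.
have [r0|r0] := leP 0 r.
  have [h1 h2] := H r r0; exists (Num.truncn r); split => //=.
  - by rewrite (ger0_norm r0).
  - by rewrite ler_norml; apply/andP; split; move: h1 h2; rewrite -pmulrn; lra.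
  - by rewrite -pmulrn (ger0_norm r0) ger0_norm.
have r0' : 0 <= - r by rewrite oppr_ge0 ltW.
have [h1 h2] := H (- r) r0'; exists (- (Num.truncn (- r))%:Z); split => //=.
- by rewrite abszN /= (ltr0_norm r0).
- by rewrite ler_norml mulrNz; apply/andP; split; move: h1 h2; rewrite -pmulrn; lra.
- by rewrite mulrNz normrN -pmulrn (ltr0_norm r0) ger0_norm.
Qed.

(** With [s = |supp x|] the scale is [c = |x| / (q sqrt s)]. Each of the [s] coordinates moves by at
    most [c], a squared error of [s c^2 = |x|^2 / q^2], while the sum of the [|x_i| / c] is at most
    [sqrt s |x| / c = q s]. *)
Lemma grid_round n (x : 'cV[R]_n) (q : nat) : (0 < q)%N -> x != 0 ->
  exists (z : {ffun 'I_n -> int}) (c : R),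
  [/\ c != 0, forall i, x i ord0 = 0 -> z i = 0,
      l2norm (c *: grid_vec z) ^+ 2 <= l2norm x ^+ 2,
      l2norm (x - c *: grid_vec z) ^+ 2 <= l2norm x ^+ 2 / q%:R ^+ 2 &
      (\sum_i `|z i|)%N%:R <= q%:R * #|supp x|%:R :> R].
Proof.
move=> q0 x0; have qR : 0 < q%:R :> R by rewrite ltr0n.
set s : R := #|supp x|%:R.
have [i0 xi0] : exists i, x i ord0 != 0.
  apply/existsP; apply: contra_neqT x0 => /existsPn H.
  by apply/matrixP => i j; rewrite ord1 mxE; apply/eqP/negPn/H.
have s0 : 0 < s by rewrite /s ltr0n card_gt0; apply/set0Pn; exists i0; rewrite inE.
have X0 : 0 < l2norm x ^+ 2.
  rewrite l2norm_sqr (bigD1 i0)//= ltr_wpDr// ?sumr_ge0// => [i _|]; first exact: sqr_ge0.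
  by rewrite exprn_even_gt0.
pose c := Num.sqrt (l2norm x ^+ 2 / (q%:R ^+ 2 * s)).
have c2 : c ^+ 2 = l2norm x ^+ 2 / (q%:R ^+ 2 * s).
  by rewrite sqr_sqrtr// ltW// divr_gt0// mulr_gt0// exprn_gt0.
have c0 : 0 < c by rewrite sqrtr_gt0 divr_gt0// mulr_gt0// exprn_gt0.
have /choice[z zP] := fun i => trunc_toward_zero (x i ord0 / c).
have zx i : `|c * (z i)%:~R| <= `|x i ord0|.
  have [_ _] := zP i; rewrite normf_div (gtr0_norm c0) ler_pdivlMr//.
  by rewrite normrM (gtr0_norm c0) mulrC.
have z0 i : x i ord0 = 0 -> z i = 0.
  move=> xi; have [+ _ _] := zP i; rewrite xi mul0r normr0 lern0 absz_eq0.
  by move/eqP.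
exists [ffun i => z i], c; split; first by rewrite gt_eqF.
- by move=> i xi; rewrite ffunE z0.
- rewrite !l2norm_sqr; apply: ler_sum => i _; rewrite !mxE ffunE.
  by rewrite -[leLHS]real_normK ?num_real// -[leRHS]real_normK ?num_real// ler_pXn2r ?nnegrE.
- apply: (@le_trans _ _ (\sum_(i in supp x) c ^+ 2)).
    rewrite l2norm_sqr [leRHS]big_mkcond/=; apply: ler_sum => i _.
    rewrite !mxE ffunE inE; case: eqP => [xi|_] /=.
      by rewrite xi (z0 _ xi) mulr0 subr0 expr0n.
    have [_ h _] := zP i.
    rewrite -[leLHS]real_normK ?num_real// ler_pXn2r ?nnegrE// ?(ltW c0)//.
    have -> : x i ord0 - c * (z i)%:~R = c * (x i ord0 / c - (z i)%:~R).
      by field; rewrite gt_eqF.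
    by rewrite normrM (gtr0_norm c0) ler_piMr// ltW.
  rewrite big_const iter_addr_0 -mulr_natr -/s c2 le_eqVlt; apply/orP; left; apply/eqP.
  by field; rewrite !gt_eqF.
- rewrite natr_sum.
  (* AM-GM: [u <= q/2 (1 + (u/q)^2)] on the support, with [u = |x_i|/c] *)
  apply: (@le_trans _ _ (\sum_(i in supp x) (q%:R / 2 + x i ord0 ^+ 2 / (2 * q%:R * c ^+ 2)))).
    rewrite [leRHS]big_mkcond/=; apply: ler_sum => i _; rewrite ffunE inE.
    case: eqP => [xi|_] /=; first by rewrite (z0 _ xi).
    have [h _ _] := zP i; apply: le_trans h _.
    rewrite normf_div (gtr0_norm c0) -[x i ord0 ^+ 2]real_normK ?num_real//.
    set u := `|x i ord0|; rewrite -subr_ge0.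
    have -> : q%:R / 2 + u ^+ 2 / (2 * q%:R * c ^+ 2) - u / c = (q%:R - u / c) ^+ 2 / (2 * q%:R).
      by field; rewrite !gt_eqF.
    by rewrite divr_ge0 ?sqr_ge0 ?mulr_ge0// ltW.
  rewrite big_split/= big_const iter_addr_0 -mulr_natr -/s -mulr_suml.
  have -> : \sum_(i in supp x) x i ord0 ^+ 2 = l2norm x ^+ 2.
    rewrite l2norm_sqr [LHS]big_mkcond/=; apply: eq_bigr => i _.
    by rewrite inE; case: eqP => //= ->; rewrite expr0n.
  (* Since [|x|^2 / c^2 = q^2 s], the two halves of the sum are both [q s / 2]. *)
  rewrite c2 le_eqVlt; apply/orP; left; apply/eqP.
  have xn0 : l2norm x != 0 by rewrite -sqrf_eq0 gt_eqF.
  by field; rewrite xn0 !gt_eqF.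
Qed.

(** Both sides of the test are homogeneous of degree two, so the scale [c] drops out and only
    integer vectors of bounded size have to be tested. *)
Lemma ric_le_of_grid m n (k delta : R) (B : 'M[R]_(m, n)) (q : nat) :
  (0 < q)%N -> 0 <= delta ->
  (forall z : {ffun 'I_n -> int}, #|supp (grid_vec z)|%:R <= k ->
     (\sum_i `|z i|)%N%:R <= q%:R * k ->
     `|defect B (grid_vec z)| <= delta * l2norm (grid_vec z) ^+ 2) ->
  ric k B <= delta + 2 / q%:R * ric k B.
Proof.
move=> q0 d0 H; apply: ric_le_of_approx => // x x0 kx.
have [z [c [c0 z0 zx dz sz]]] := grid_round q0 x0.
exists (c *: grid_vec z); split => //.
- by move=> i /z0 zi; rewrite !mxE zi mulr0.
- rewrite defectZ l2normZ normrM ger0_norm ?sqr_ge0// mulrCA ler_wpM2l ?sqr_ge0//.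
  apply: H; last by apply: le_trans sz _; rewrite ler_wpM2l.
  apply: le_trans kx; rewrite ler_nat subset_leq_card//.
  by apply/fintype.subsetP => i; rewrite !inE mxE; apply: contra_neq => /z0 ->.
Qed.

(** Turns the bound into countably many conditions, which makes the event measurable. *)
Lemma ric_le_gridP m n (k delta : R) (B : 'M[R]_(m, n)) : 0 <= delta ->
  ric k B <= delta <->
  forall z : {ffun 'I_n -> int}, #|supp (grid_vec z)|%:R <= k ->
    `|defect B (grid_vec z)| <= delta * l2norm (grid_vec z) ^+ 2.
Proof.
move=> d0; split=> [/(ric_leP k B d0)/ric_boundP H z|H]; first exact: H.
rewrite leNgt; apply/negP => ltM.
have [M0 _ _] := ric_is_smallest k B; set M := ric k B in M0 ltM *.
have dM : 0 < M - delta by rewrite subr_gt0.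
(* Chosen so that [2 M / q < M - delta], which contradicts [M <= delta + 2 M / q]. *)
pose q := (Num.truncn (2 * M / (M - delta))).+1.
have := ric_le_of_grid (q := q) isT d0 (fun z kz _ => H z kz); rewrite -/M.
apply/negP; rewrite -ltNge -ltrBrDl mulrAC ltr_pdivrMr ?ltr0n// mulrC -ltr_pdivrMl// mulrC.
by rewrite [ltLHS]mulrC; exact: truncnS_gt.
Qed.

(** The case [q = 4]: [M <= delta / 2 + M / 2]. *)
Lemma ric_le_of_net m n (k delta : R) (B : 'M[R]_(m, n)) : 0 <= delta ->
  (forall z : {ffun 'I_n -> int}, #|supp (grid_vec z)|%:R <= k ->
     (\sum_i `|z i|)%N%:R <= 4 * k ->
     `|defect B (grid_vec z)| <= delta / 2 * l2norm (grid_vec z) ^+ 2) ->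
  ric k B <= delta.
Proof.
move=> d0 H; have := @ric_le_of_grid m n k (delta / 2) B 4 isT _ H.
by rewrite divr_ge0// => /(_ isT); lra.
Qed.

End rip_grid.

(** * Chains driven by independent variables *)

Section markov_chain.
Local Open Scope ereal_scope.
Context (R : realType) dO (Omega : measurableType dO) (P : probability Omega R).
Context dS dT (S : measurableType dS) (T : measurableType dT).
Variables (X : nat -> Omega -> T) (g : nat -> S * T -> S) (y0 : S) (N : nat).
Hypothesis mX : forall j, measurable_fun [set: Omega] (X j).
Hypothesis mg : forall j, measurable_fun [set: S * T] (g j).
Hypothesis indepX : forall B : nat -> set T, (forall j, measurable (B j)) ->
  P (\bigcap_(j in [set j | (0 <= j < N)%N]) X j @^-1` B j) =
  \prod_(0 <= j < N) P (X j @^-1` B j).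

(** A state driven by [X 0, ..., X (l - 1)]. It is a real partial sum of squares for rows and a
    vector partial sum for columns. *)
Fixpoint chain l w : S :=
  if l is l'.+1 then g l' (chain l' w, X l' w) else y0.

Lemma measurable_chain l : measurable_fun [set: Omega] (chain l).
Proof.
elim: l => [|l IH] /=; first exact: measurable_cst.
by apply: measurableT_comp; [exact: mg|exact: measurable_fun_pair].
Qed.

Let mpre l (A : set S) : measurable A -> measurable (chain l @^-1` A).
Proof. by move=> mA; rewrite -[X in measurable X]setTI; exact: measurable_chain. Qed.

Let mpreX l (A : set T) : measurable A -> measurable (X l @^-1` A).
Proof. by move=> mA; rewrite -[X in measurable X]setTI; exact: mX. Qed.

Let future l (B : nat -> set T) :=
  \bigcap_(j in [set j | (l <= j < N)%N]) X j @^-1` B j.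

Let mfuture l B : (forall j, measurable (B j)) -> measurable (future l B).
Proof. by move=> mB; apply: bigcap_measurableType => // j _; exact: mpreX. Qed.

Let futureS l (B B' : nat -> set T) A : (l < N)%N -> 
  B' = (fun j => if j == l then A else B j) ->
  future l B' = X l @^-1` A `&` future l.+1 B.
Proof.
move=> lN ->; apply/seteqP; split => w /=.
  move=> H; split; first by have := H l; rewrite /= eqxx leqnn lN; exact.
  move=> j /= /andP[lj jN]; have := H j; rewrite /= (ltnW lj) jN gtn_eqF//.
  exact.
move=> [Aw H] j /= /andP[lj jN]; case: eqP => [->//|/eqP jl].
by apply: H => /=; rewrite jN andbT ltn_neqAle eq_sym jl.
Qed.

Let futureT l : future l (fun=> setT) = setT.
Proof. by apply/seteqP; split. Qed.

(** The induction carries independence of the state from all later variables at once, since each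
    step has to split off [X l] and keep the rest. *)
Let indep_at l := forall A B, measurable A -> (forall j, measurable (B j)) ->
  P (chain l @^-1` A `&` future l B) =
  P (chain l @^-1` A) * \prod_(l <= j < N) P (X j @^-1` B j).

Let indep_pair l : (l < N)%N -> indep_at l ->
  forall A C B, measurable A -> measurable C -> (forall j, measurable (B j)) ->
  P (chain l @^-1` A `&` X l @^-1` C `&` future l.+1 B) =
  P (chain l @^-1` A) * P (X l @^-1` C) *
  \prod_(l.+1 <= j < N) P (X j @^-1` B j).
Proof.
move=> lN IH A C B mA mC mB.
pose B' j := if j == l then C else B j.
have := IH A B' mA; rewrite (futureS (B := B) (B' := B') (A := C))// setIA => ->.
  rewrite big_ltn// /B' eqxx muleA; congr (_ * _).
  by apply: eq_big_nat => j /andP[lj _]; rewrite gtn_eqF.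
by move=> j; rewrite /B'; case: eqP.
Qed.

Let pair l w := (chain l w, X l w).

Let mpair l : measurable_fun [set: Omega] (pair l).
Proof. by apply: measurable_fun_pair => //; exact: measurable_chain. Qed.

(** Both sides are finite measures in [D] that agree on rectangles, a pi-system generating the
    product sigma-algebra; hence they agree everywhere. *)
Let indep_joint l : (l < N)%N -> indep_at l ->
  forall D B, measurable D -> (forall j, measurable (B j)) ->
  P (pair l @^-1` D `&` future l.+1 B) =
  P (pair l @^-1` D) * \prod_(l.+1 <= j < N) P (X j @^-1` B j).
Proof.
move=> lN IH D B mD mB.
pose E := future l.+1 B; have mE : measurable E by exact: mfuture.
pose q := fine (\prod_(l.+1 <= j < N) P (X j @^-1` B j)).
have qE : \prod_(l.+1 <= j < N) P (X j @^-1` B j) = q%:E.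
  rewrite /q fineK//; elim/big_ind : _ => // [x y|i _]; first exact: fin_numM.
  exact/fin_num_measure/mpreX.
have q0 : (0 <= q)%R.
  rewrite fine_ge0//; elim/big_ind : _ => // x y; exact: mule_ge0.
pose m1 : {measure set (S * T) -> \bar R} :=
  pushforward (mrestr P mE) (pair l).
pose m2 : {measure set (S * T) -> \bar R} :=
  mscale (NngNum q0) (pushforward P (pair l)).
pose C : set (set (S * T)) := [set A `*` B | A in measurable & B in measurable].
rewrite qE muleC -[LHS]/(m1 (@mpair l) D) -[RHS]/(m2 (@mpair l) D).
apply: (measure_unique C (fun=> setT)) => //.
- exact: measurable_prod_measurableType.
- move=> _ _ [A1 mA1 [A2 mA2 <-]] [B1 mB1 [B2 mB2 <-]]; rewrite -setXI.
  exists (A1 `&` B1); first exact: measurableI.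
  by exists (A2 `&` B2) => //; exact: measurableI.
- by move=> _; exists setT => //; exists setT => //; rewrite setXTT.
- by apply/seteqP; split => // x _; exists 0%N.
- move=> _ [A mA [A' mA' <-]].
  have pE : pair l @^-1` (A `*` A') = chain l @^-1` A `&` X l @^-1` A' by [].
  rewrite /m1 /m2 /= /mscale /pushforward /= /mrestr pE indep_pair// qE muleC.
  have := indep_pair lN IH mA mA' (fun=> measurableT).
  rewrite futureT setIT /pushforward pE => ->.
  rewrite [X in _ * (_ * _ * X)]big1 ?mule1// => j _.
  by rewrite preimage_setT probability_setT.
- move=> _; rewrite /m1 /pushforward/= /mrestr (@le_lt_trans _ _ 1)//; last exact: ltry.
  by apply: probability_le1; rewrite preimage_setT setTI.
Qed.

Let indep_atP l : (l <= N)%N -> indep_at l.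
Proof.
elim: l => [_|l IH lN] A B mA mB.
  (* The initial state is constant, so its event is everything or empty. *)
  rewrite /chain; have [yA|yA] := pselect (A y0).
    rewrite (_ : (fun=> y0) @^-1` A = setT); last by apply/seteqP; split.
    by rewrite setTI probability_setT mul1e; exact: indepX.
  rewrite (_ : (fun=> y0) @^-1` A = set0) ?set0I ?measure0 ?mul0e//.
  by apply/seteqP; split.
have -> : chain l.+1 @^-1` A = pair l @^-1` (g l @^-1` A) by [].
apply: indep_joint => //; first by apply: IH; exact: ltnW.
by rewrite -[X in measurable X]setTI; exact: mg.
Qed.

(** The state is independent of [X l], so the joint law is the product law, and Tonelli integrates
    [X l] first with the state frozen. *)
Lemma chain_transfer l (V : S * T -> \bar R) : (l < N)%N ->
  measurable_fun [set: S * T] V -> (forall z, 0 <= V z) ->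
  \int[P]_w V (chain l w, X l w) =
  \int[P]_w \int[P]_v V (chain l w, X l v).
Proof.
move=> lN mV V0.
have IH := indep_atP (ltnW lN).
pose Ym := isMeasurableFun.Build _ _ _ _ _ (@measurable_chain l).
pose Y : {mfun Omega >-> S} := HB.pack (chain l) Ym.
pose Zm := isMeasurableFun.Build _ _ _ _ _ (@mX l).
pose Z : {mfun Omega >-> T} := HB.pack (X l) Zm.
pose Wm := isMeasurableFun.Build _ _ _ _ _ (@mpair l).
pose W : {mfun Omega >-> (S * T)%type} := HB.pack (pair l) Wm.
transitivity (\int[distribution P W]_z V z); first by rewrite ge0_integral_distribution.
transitivity (\int[distribution P Y \x distribution P Z]_z V z).
  apply: eq_measure_integral => /= A mA _; apply/esym.
  apply: product_measure_unique => // B C mB mC.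
  have := indep_pair lN IH mB mC (fun=> measurableT).
  rewrite futureT setIT big1; first by rewrite mule1; exact.
  by move=> j _; rewrite preimage_setT probability_setT.
rewrite fubini_tonelli1// /fubini_F ge0_integral_distribution//; first last.
- by move=> y; apply: integral_ge0.
- exact: measurable_fun_fubini_tonelli_F.
apply: eq_integral => w _ /=; rewrite ge0_integral_distribution//.
exact: measurableT_comp.
Qed.

Lemma chain_supermartingale (V : nat -> S -> \bar R) :
  (forall l, measurable_fun setT (V l)) -> (forall l s, 0 <= V l s) ->
  (forall l s, (l < N)%N -> \int[P]_w V l.+1 (g l (s, X l w)) <= V l s) ->
  \int[P]_w V N (chain N w) <= V 0%N y0.
Proof.
move=> mV V0 Vle.
suff H l : (l <= N)%N -> \int[P]_w V l (chain l w) <= V 0%N y0 by exact: H.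
elim: l => [_|l IH lN] /=.
  by rewrite integral_cst //= probability_setT mule1.
apply: le_trans (IH (ltnW lN)).
have mVg : measurable_fun [set: S * T] (V l.+1 \o g l) by exact: measurableT_comp.
have := chain_transfer lN mVg (fun z => V0 _ _).
move=> /= ->; apply: ge0_le_integral => //.
- by move=> w _; apply: integral_ge0.
(* The inner integral is measurable in the state by Tonelli for the law of [X l]. *)
- pose Zm := isMeasurableFun.Build _ _ _ _ _ (@mX l).
  pose Z : {mfun Omega >-> T} := HB.pack (X l) Zm.
  have := @measurable_fun_fubini_tonelli_F _ _ _ _ R (distribution P Z)
    (V l.+1 \o g l) mVg (fun z => V0 _ _).
  move=> /measurableT_comp /(_ (@measurable_chain l)).
  apply: eq_measurable_fun => w _ /=.
  rewrite /fubini_F ge0_integral_distribution//; first exact: measurableT_comp.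
  by move=> y; exact: V0.
- exact: (measurableT_comp (mV l) (@measurable_chain l)).
- by move=> w _; exact: Vle.
Qed.

End markov_chain.

(** * Sub-gaussian moment generating functions *)

Section subgaussian.
Context (R : realType) d (Omega : measurableType d) (P : probability Omega R).

(** [n^n / n!] is a single term of the series of [e^n]. *)
Lemma expnn_le_fact (n : nat) : n%:R ^+ n <= expR n%:R * n`!%:R :> R.
Proof.
case: n => [|n]; first by rewrite expr0 expR0 fact0 mulr1.
rewrite -ler_pdivrMr ?ltr0n ?fact_gt0//.
apply: le_trans (expR_ge1Dxn n (ler0n R n.+1)).
by rewrite lerDr.
Qed.

Lemma psi2norm_moment (Z : Omega -> R) (K : R) (q : nat) : 0 <= K ->
  (psi2norm P Z <= K%:E)%E ->
  (\int[P]_w ((Z w ^+ 2) ^+ q)%:E <= ((K ^+ 2 * (2 * q%:R)) ^+ q)%:E)%E.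
Proof.
move=> K0 ZK; case: q => [|q].
  (* The exponent [p = 2 q] must be at least 1, so [q = 0] is treated apart. *)
  rewrite expr0; under eq_integral do rewrite expr0.
  by rewrite integral_cst //= probability_setT mule1.
have p1 : (1 : R) <= 2 * q.+1%:R by rewrite -natrM ler1n.
have p0 : 0 < 2 * q.+1%:R :> R by apply: lt_le_trans p1.
set p : R := 2 * q.+1%:R in p1 p0 *.
have NK : (Lnorm P p%:E (EFin \o Z) <= (K * p `^ (2^-1))%:E)%E.
  have : ((p `^ (- 2^-1))%:E * Lnorm P p%:E (EFin \o Z) <= K%:E)%E.
    by apply: le_trans ZK; apply: ereal_sup_ubound; exists p.
  rewrite powRN muleC -lee_pdivlMr ?invr_gt0 ?powR_gt0//.
  by rewrite -EFinM invrK.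
have pE : p = (2 * q.+1)%:R by rewrite /p natrM.
rewrite (_ : (\int[P]_w _ = \int[P]_w `|(EFin \o Z) w| `^ p)%E); last first.
  apply: eq_integral => w _ /=.
  by rewrite pE powR_mulrn// exprM real_normK// num_real.
rewrite -powR_Lnorm ?gt_eqF//.
have c0 : 0 <= K * p `^ (2^-1) by rewrite mulr_ge0// powR_ge0.
apply: (le_trans (gt0_ler_poweR (ltW p0) _ _ NK)).
- by rewrite in_itv/= leey andbT Lnorm_ge0.
- by rewrite in_itv/= leey andbT lee_fin.
have sqrt2 : (p `^ 2^-1) ^+ 2 = p.
  by rewrite -powR_mulrn ?powR_ge0// -powRrM mulVf// powRr1// ltW.
set c := _ * _ in c0 *; rewrite poweR_EFin {1}pE powR_mulrn// exprM /c.
by rewrite [in X in X ^+ _]exprMn sqrt2.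
Qed.

(** Expanding the exponential, the [n]-th term is at most [(2 a n K^2)^n / n! <= (2 a e K^2)^n =
    2^-n] for this [a], and the series sums to at most 2. *)
Lemma psi2norm_exp_sqr (Z : Omega -> R) (K : R) : 0 < K ->
  measurable_fun setT Z -> (psi2norm P Z <= K%:E)%E ->
  (\int[P]_w (expR ((4 * expR 1 * K ^+ 2)^-1 * Z w ^+ 2))%:E <= 2%:E)%E.
Proof.
move=> K0 mZ ZK; set a := (_)^-1.
have a0 : 0 <= a.
  by rewrite invr_ge0; apply: mulr_ge0; [rewrite mulr_ge0 ?expR_ge0|rewrite sqr_ge0].
pose f n w := (exp_coeff (a * Z w ^+ 2) n)%:E.
have f0 n w : (0 <= f n w)%E.
  by rewrite lee_fin exp_coeff_ge0// mulr_ge0// sqr_ge0.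
have mf n : measurable_fun setT (f n).
  apply/measurable_EFinP; rewrite /exp_coeff/=.
  apply: measurable_funM => //; apply: measurable_funX.
  by apply: measurable_funM => //; exact: measurable_funX.
have -> : (\int[P]_w (expR (a * Z w ^+ 2))%:E = \int[P]_w \sum_(n <oo) f n w)%E.
  apply: eq_integral => w _; rewrite /f /expR -EFin_lim; last exact: is_cvg_series_exp_coeff.
  by congr (limn _); apply/funext => n /=; rewrite /series /= sumEFin.
rewrite integral_nneseries//; apply: lime_le.
  by apply: is_cvg_nneseries => n _ _; apply: integral_ge0.
apply: nearW => N /=.
have H n : (\int[P]_w f n w <= ((2^-1) ^+ n)%:E)%E.
  have fE w : f n w = ((a ^+ n / n`!%:R)%:E * ((Z w ^+ 2) ^+ n)%:E)%E.
    by rewrite /f /exp_coeff /= exprMn -EFinM mulrAC.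
  under eq_integral do rewrite fE.
  rewrite ge0_integralZl//; last 3 first.
  - by apply/measurable_EFinP; do 2 apply: measurable_funX.
  - by move=> w _; rewrite lee_fin exprn_ge0// sqr_ge0.
  - by rewrite lee_fin divr_ge0// exprn_ge0.
  apply: (@le_trans _ _ ((a ^+ n / n`!%:R)%:E * ((K ^+ 2 * (2 * n%:R)) ^+ n)%:E)%E).
    by apply: lee_pmul => //; [rewrite lee_fin divr_ge0// exprn_ge0|
       apply: integral_ge0 => w _; rewrite lee_fin exprn_ge0// sqr_ge0|
       exact: psi2norm_moment (ltW K0) ZK].
  rewrite -EFinM lee_fin mulrAC ler_pdivrMr ?ltr0n ?fact_gt0// -exprMn.
  have -> : a * (K ^+ 2 * (2 * n%:R)) = 2^-1 * ((expR 1)^-1 * n%:R).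
    by rewrite /a; field; rewrite !gt_eqF ?expR_gt0.
  rewrite exprMn ler_wpM2l ?exprn_ge0 ?invr_ge0// exprMn exprVn -expRM_natl mulr1.
  by rewrite mulrC ler_pdivrMr ?expR_gt0// mulrC expnn_le_fact.
apply: le_trans (lee_sum _ (fun n _ => H n)) _; rewrite sumEFin lee_fin.
have -> : \sum_(0 <= i < N) 2^-1 ^+ i = 2 - 2 * 2^-1 ^+ N :> R.
  elim: N => [|N IH]; first by rewrite big_geq// expr0; lra.
  by rewrite big_nat_recr//= IH exprS; lra.
by rewrite lerBlDr lerDl mulr_ge0// exprn_ge0.
Qed.

(** Completing the square: [t z <= a z^2 + t^2 / (4 a)]. *)
Lemma exp_sqr_mgf (Z : Omega -> R) (a t : R) : 0 < a ->
  measurable_fun setT Z ->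
  (\int[P]_w (expR (a * Z w ^+ 2))%:E <= 2%:E)%E ->
  (\int[P]_w (expR (t * Z w))%:E <= (2 * expR (t ^+ 2 / (4 * a)))%:E)%E.
Proof.
move=> a0 mZ HZ; pose b := expR (t ^+ 2 / (4 * a)).
have mE c : measurable_fun setT (fun w => (expR (c * Z w ^+ 2))%:E).
  apply/measurable_EFinP/measurableT_comp => //.
  by apply: measurable_funM => //; exact: measurable_funX.
apply: (@le_trans _ _ (\int[P]_w (b%:E * (expR (a * Z w ^+ 2))%:E))%E).
  apply: ge0_le_integral => //.
  - apply/measurable_EFinP; apply: measurableT_comp => //.
    by apply: measurable_funM => //; exact: measurable_cst.
  - by apply: emeasurable_funM => //; exact: measurable_cst.
  - move=> w _; rewrite -EFinM lee_fin /b -expRD ler_expR.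
    have -> : t ^+ 2 / (4 * a) + a * Z w ^+ 2 = t * Z w + a * (Z w - t / (2 * a)) ^+ 2.
      by field; rewrite gt_eqF.
    by rewrite lerDl mulr_ge0 ?sqr_ge0// ltW.
rewrite ge0_integralZl//; last by rewrite lee_fin expR_ge0.
by rewrite mulrC EFinM lee_pmul2l// lte_fin expR_gt0.
Qed.

Lemma expR_le_quadratic (u : R) : expR u <= 1 + u + u ^+ 2 * expR `|u|.
Proof.
have [u0|u0] := leP 0 u.
  rewrite ger0_norm//.
  (* This is [1 - u <= e^-u] times [e^u]; inserting it into itself gives the quadratic term. *)
  have h : expR u <= 1 + u * expR u.
    have := ler_wpM2r (expR_ge0 u) (expR_ge1Dx (- u)).
    by rewrite -expRD addNr expR0; lra.
  have := ler_wpM2l u0 h; rewrite mulrDr mulr1 mulrA -expr2; lra.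
have [v v0 ->] : exists2 v, 0 < v & u = - v by exists (- u); rewrite ?opprK ?oppr_gt0.
rewrite normrN gtr0_norm// sqrrN.
have e1 : 1 <= expR v by rewrite -expR0 ler_expR ltW.
have h : expR (- v) <= (1 + v)^-1.
  by rewrite expRN lef_pV2 ?posrE ?expR_gt0 ?expR_ge1Dx// addr_gt0.
(* Here [(1 - v + v^2) (1 + v) = 1 + v^3 >= 1]. *)
apply: (le_trans h); apply: (@le_trans _ _ (1 - v + v ^+ 2)).
  rewrite -[leLHS]mul1r ler_pdivrMr ?addr_gt0//.
  have := exprn_ge0 3 (ltW v0); rewrite !exprS expr0; nra.
by rewrite lerD2l ler_peMr// sqr_ge0.
Qed.

(** With [w = z^2 - 1], half of the exponent [a |w|] absorbs [w^2] and the other half absorbs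
    [e^|t w|]; then [|w| <= z^2 + 1] produces the factor [e^a]. *)
Lemma exp_centered_sqr_le (a t z : R) : 0 < a -> `|t| <= a / 2 ->
  expR (t * (z ^+ 2 - 1)) <=
  1 + t * (z ^+ 2 - 1) + 8 * expR a / a ^+ 2 * t ^+ 2 * expR (a * z ^+ 2).
Proof.
move=> a0 ta; set w := z ^+ 2 - 1; apply: le_trans (expR_le_quadratic _) _.
rewrite lerD2l normrM.
have wz : `|w| <= z ^+ 2 + 1.
  by rewrite ler_norml /w; have := sqr_ge0 z; lra.
have x0 : 0 <= a / 2 * `|w| by rewrite mulr_ge0// divr_ge0// ltW.
have w2 : w ^+ 2 <= 8 / a ^+ 2 * expR (a / 2 * `|w|).
  have := expR_ge1Dxn 1 x0; rewrite exprMn real_normK ?num_real// => h.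
  have {}h : (a / 2) ^+ 2 * w ^+ 2 / 2 <= expR (a / 2 * `|w|).
    by apply: le_trans h; rewrite lerDr.
  rewrite mulrAC ler_pdivlMr ?exprn_gt0//; lra.
have h1 : expR (`|t| * `|w|) <= expR (a / 2 * `|w|) by rewrite ler_expR ler_wpM2r.
rewrite exprMn.
apply: (@le_trans _ _ (t ^+ 2 * (8 / a ^+ 2 * expR (a / 2 * `|w|)) * expR (a / 2 * `|w|))).
  apply: ler_pM; rewrite ?expR_ge0//; first by rewrite -exprMn sqr_ge0.
  by rewrite ler_wpM2l ?sqr_ge0.
have -> : t ^+ 2 * (8 / a ^+ 2 * expR (a / 2 * `|w|)) * expR (a / 2 * `|w|) =
    8 / a ^+ 2 * t ^+ 2 * expR (a * `|w|).
  have -> : a * `|w| = a / 2 * `|w| + a / 2 * `|w| by field.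
  by rewrite expRD; ring.
have -> : 8 * expR a / a ^+ 2 * t ^+ 2 * expR (a * z ^+ 2) =
    8 / a ^+ 2 * t ^+ 2 * expR (a * (z ^+ 2 + 1)).
  by rewrite mulrDr mulr1 expRD; ring.
rewrite ler_wpM2l//.
  by apply: mulr_ge0; [rewrite divr_ge0// sqr_ge0|rewrite sqr_ge0].
by rewrite ler_expR ler_wpM2l// ltW.
Qed.

(** Integrating [exp_centered_sqr_le], the linear term vanishes as the second moment is 1, and the
    remainder at most doubles. *)
Lemma centered_sqr_mgf (Z : Omega -> R) (a t : R) : 0 < a -> `|t| <= a / 2 ->
  measurable_fun setT Z ->
  (\int[P]_w (Z w ^+ 2)%:E = 1)%E ->
  (\int[P]_w (expR (a * Z w ^+ 2))%:E <= 2%:E)%E ->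
  (\int[P]_w (expR (t * (Z w ^+ 2 - 1)))%:E <=
   (expR (16 * expR a / a ^+ 2 * t ^+ 2))%:E)%E.
Proof.
move=> a0 ta mZ Z1 HZ.
(* Splitting [t] into positive and negative parts moves the negative terms to the other side, so
   that only nonnegative functions are integrated. *)
pose tp := Num.max t 0; pose tn := Num.max (- t) 0.
have tp0 : 0 <= tp by rewrite le_max lexx orbT.
have tn0 : 0 <= tn by rewrite le_max lexx orbT.
have tE : t = tp - tn.
  by rewrite /tp /tn; case: (leP t 0); case: (leP (- t) 0); lra.
pose B := 8 * expR a / a ^+ 2 * t ^+ 2.
have B0 : 0 <= B.
  apply: mulr_ge0; last by rewrite sqr_ge0.
  by apply: divr_ge0; [rewrite mulr_ge0 ?expR_ge0|rewrite sqr_ge0].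
have mZ2 : measurable_fun setT (fun w => Z w ^+ 2) by exact: measurable_funX.
have mC (c : R) : measurable_fun [set: Omega] (fun=> c) by exact: measurable_cst.
have mL c : measurable_fun setT (fun w => c * Z w ^+ 2) by exact: measurable_funM.
have mE c : measurable_fun setT (fun w => B * expR (c * Z w ^+ 2)).
  by apply: measurable_funM => //; exact: measurableT_comp.
have m1 : measurable_fun setT (fun w => expR (t * (Z w ^+ 2 - 1))).
  by apply: measurableT_comp => //; apply: measurable_funM => //; exact: measurable_funB.
have iC (c : R) : (\int[P]_w c%:E = c%:E)%E.
  by rewrite integral_cst//= probability_setT mule1.
have iZ c (f : Omega -> R) : 0 <= c -> measurable_fun setT f ->
    (forall w, 0 <= f w) -> (\int[P]_w (c * f w)%:E = c%:E * \int[P]_w (f w)%:E)%E.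
  move=> c0 mf f0; under eq_integral do rewrite EFinM.
  by rewrite ge0_integralZl ?lee_fin//; [exact/measurable_EFinP|move=> w _; rewrite lee_fin].
have iD (f g : Omega -> R) : measurable_fun setT f -> measurable_fun setT g ->
    (forall w, 0 <= f w) -> (forall w, 0 <= g w) ->
    (\int[P]_w (f w + g w)%:E = \int[P]_w (f w)%:E + \int[P]_w (g w)%:E)%E.
  move=> mf mg f0 g0; under eq_integral do rewrite EFinD.
  by rewrite ge0_integralD//; [move=> w _; rewrite lee_fin|exact/measurable_EFinP|
    move=> w _; rewrite lee_fin|exact/measurable_EFinP].
have Z20 c w : 0 <= c -> 0 <= c * Z w ^+ 2 by move=> c0; rewrite mulr_ge0 ?sqr_ge0.
have E0 c w : 0 <= B * expR (c * Z w ^+ 2) by rewrite mulr_ge0 ?expR_ge0.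
pose f w := expR (t * (Z w ^+ 2 - 1)) + (tn * Z w ^+ 2 + tp).
pose h w := B * expR (a * Z w ^+ 2) + (tp * Z w ^+ 2 + (tn + 1)).
have : (\int[P]_w (f w)%:E <= \int[P]_w (h w)%:E)%E.
  apply: ge0_le_integral => //.
  - by move=> w _; rewrite lee_fin !addr_ge0 ?expR_ge0 ?Z20.
  - by apply/measurable_EFinP; apply: measurable_funD => //; exact: measurable_funD.
  - by apply/measurable_EFinP; apply: measurable_funD => //; exact: measurable_funD.
  - move=> w _; rewrite lee_fin; have := exp_centered_sqr_le (Z w) a0 ta.
    rewrite -/B {2}tE /f /h; lra.
rewrite /f iD//; last 2 first.
- exact: measurable_funD.
- by move=> w; rewrite addr_ge0 ?Z20.
rewrite iD//; last by move=> w; exact: Z20.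
rewrite iZ//; last by move=> w; exact: sqr_ge0.
rewrite Z1 mule1 iC /h iD//; last 2 first.
- exact: measurable_funD.
- by move=> w; rewrite !addr_ge0 ?Z20.
rewrite [X in (_ <= _ + X)%E -> _]iD//; last 2 first.
- by move=> w; exact: Z20.
- by move=> w; rewrite addr_ge0.
rewrite iC [X in (_ <= _ + (X + _))%E -> _]iZ//; last by move=> w; exact: sqr_ge0.
rewrite Z1 mule1 iZ//; last exact: measurableT_comp.
move=> H; have {H} : (\int[P]_w (expR (t * (Z w ^+ 2 - 1)))%:E + (tn + tp)%:E <=
    (2 * B + 1)%:E + (tn + tp)%:E)%E.
  apply: (le_trans H).
  apply: (@le_trans _ _ (B%:E * 2%:E + (tp%:E + (tn + 1)%:E))%E).
    by apply: leeD => //; apply: lee_wpmul2l.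
  by rewrite -EFinM -!EFinD lee_fin; lra.
rewrite leeD2rE// => H; apply: (le_trans H); rewrite lee_fin addrC.
apply: le_trans (expR_ge1Dx _) _; rewrite ler_expR /B.
by rewrite le_eqVlt; apply/orP; left; apply/eqP; ring.
Qed.

End subgaussian.

(** * Random vectors and the two models *)

Section borel_vectors.
Context {R : realType} {d : nat}.

Let borel_set0 : @borel_vec R d set0.
Proof. exact: sigma_algebra0. Qed.

Let borel_setC A : @borel_vec R d A -> borel_vec (~` A).
Proof. exact: sigma_algebraC. Qed.

Let borel_bigcup (F : (set 'cV[R]_d)^nat) : (forall i, borel_vec (F i)) ->
  borel_vec (\bigcup_i F i).
Proof. exact: sigma_algebra_bigcup. Qed.

(** With this instance [measurable] sets of vectors are exactly those quantified over in
    [mutually_independent]. *)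
HB.instance Definition _ := @isMeasurable.Build default_measure_display
  'cV[R]_d borel_vec borel_set0 borel_setC borel_bigcup.

Lemma measurable_coord (i : 'I_d) :
  measurable_fun [set: 'cV[R]_d] (fun x => x i ord0).
Proof.
move=> _ Y mY; rewrite setTI; apply: sub_sigma_algebra => /=.
rewrite -bigcup_seq/=; exists i => /=; first by rewrite mem_index_enum.
by exists Y => //; rewrite setTI.
Qed.

Lemma measurable_fun_cV dT (T : measurableType dT) (f : T -> 'cV[R]_d) :
  (forall i, measurable_fun [set: T] (fun t => f t i ord0)) ->
  measurable_fun [set: T] f.
Proof.
move=> mf; apply: (measurability
  (\big[setU/set0]_(i < d) preimage_set_system setT
     (fun x : 'cV[R]_d => x i ord0) measurable)) => //.
move=> _ [B + <-]; rewrite -bigcup_seq => -[i _ [C mC <-]].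
by rewrite !setTI -[X in measurable X]setTI; exact: mf.
Qed.

Lemma measurable_dot (v : 'cV[R]_d) :
  measurable_fun [set: 'cV[R]_d] (fun x => dot x v).
Proof.
apply: measurable_sum => i; apply: measurable_funM; last exact: measurable_cst.
exact: measurable_coord.
Qed.

Lemma measurable_l2norm_sqr :
  measurable_fun [set: 'cV[R]_d] (fun x => l2norm x ^+ 2).
Proof.
under eq_fun do rewrite l2norm_sqr.
by apply: measurable_sum => i; apply: measurable_funX; exact: measurable_coord.
Qed.

End borel_vectors.

Section nat_families.

(** Chains are indexed by [nat]; the default value is taken only beyond the first [N] indices. *)
Definition nat_ext {A : Type} {N : nat} (a0 : A) (f : 'I_N -> A) (j : nat) : A :=
  oapp f a0 (insub j).

Lemma nat_extE A N (a0 : A) (f : 'I_N -> A) (i : 'I_N) : nat_ext a0 f i = f i.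
Proof. by rewrite /nat_ext valK. Qed.

Lemma nat_ext_lt A N (a0 : A) (f : 'I_N -> A) j (jN : (j < N)%N) :
  nat_ext a0 f j = f (Ordinal jN).
Proof. by rewrite -(nat_extE a0). Qed.

Context {R : realType} dO (Omega : measurableType dO) (P : probability Omega R).

Lemma measurable_nat_ext N d (X : 'I_N -> Omega -> 'cV[R]_d) j :
  (forall i, measurable_fun [set: Omega] (X i)) ->
  measurable_fun [set: Omega] (nat_ext (cst 0) X j).
Proof.
by move=> mX; rewrite /nat_ext; case: insub => /= [i|]; [exact: mX|exact: measurable_cst].
Qed.

Lemma mutually_independent_nat N d (X : 'I_N -> Omega -> 'cV[R]_d) :
  mutually_independent P X ->
  forall B : nat -> set 'cV[R]_d, (forall j, measurable (B j)) ->
  (P (\bigcap_(j in [set j | (0 <= j < N)%N]) nat_ext (cst 0%R) X j @^-1` B j) =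
  \prod_(0 <= j < N) P (nat_ext (cst 0%R) X j @^-1` B j))%E.
Proof.
move=> iX B mB; rewrite big_mkord.
have := iX [set: 'I_N]%SET (fun i => B i) (fun i _ => mB i).
under [X in _ = X -> _]eq_bigl do rewrite finset.in_setT.
under [X in _ = X -> _]eq_bigr do rewrite -(nat_extE (cst 0)).
move=> <-; congr (P _); apply/seteqP; split => w /= H.
  by move=> i _; have := H i (ltn_ord i); rewrite nat_extE.
move=> j /= jN; rewrite (nat_ext_lt _ _ jN).
by apply: (H (Ordinal jN)) => /=; rewrite finset.in_setT.
Qed.

End nat_families.

Section isotropic_vectors.
Context {R : realType} dO (Omega : measurableType dO) (P : probability Omega R).

(** The square expands into a double sum. Linearity needs integrability: the squares have finite
    integral by isotropy, and they dominate the mixed products. *)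
Lemma isotropic_dot d (X : Omega -> 'cV[R]_d) (x : 'cV[R]_d) :
  (forall i, measurable_fun [set: Omega] (fun w => X w i ord0)) ->
  isotropic P X ->
  (\int[P]_w (dot (X w) x ^+ 2)%:E = (l2norm x ^+ 2)%:E)%E.
Proof.
move=> mX isoX.
have XX i j : (\int[P]_w (X w i ord0 * X w j ord0)%:E = ((1%:M : 'M[R]_d) i j)%:E)%E.
  by rewrite -isoX unlock.
have sqr_int i : P.-integrable setT (fun w => (X w i ord0 ^+ 2)%:E).
  apply/integrableP; split; first by apply/measurable_EFinP/measurable_funX.
  under eq_integral do rewrite gee0_abs ?lee_fin ?sqr_ge0// expr2.
  by rewrite XX ltry.
have XXi i j : P.-integrable setT (fun w => (X w i ord0 * X w j ord0)%:E).
  apply: le_integrable (integrableD measurableT (sqr_int i) (sqr_int j)) => //.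
    by apply/measurable_EFinP; exact: measurable_funM.
  move=> w _ /=; rewrite lee_fin [leRHS]ger0_norm ?addr_ge0 ?sqr_ge0//.
  have := sqr_ge0 (X w i ord0 + X w j ord0).
  have := sqr_ge0 (X w i ord0 - X w j ord0).
  have := sqr_ge0 (X w i ord0); have := sqr_ge0 (X w j ord0).
  rewrite sqrrB sqrrD => ? ? ? ?.
  by rewrite ler_norml; apply/andP; split; lra.
have sqrE w : (dot (X w) x ^+ 2)%:E = (\sum_(ij : 'I_d * 'I_d)
    (x ij.1 ord0 * x ij.2 ord0)%:E * (X w ij.1 ord0 * X w ij.2 ord0)%:E)%E.
  rewrite /dot expr2 big_distrlr /= pair_bigA /= -sumEFin.
  by apply: eq_bigr => ij _; rewrite -EFinM mulrACA [in LHS]mulrC.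
under eq_integral do rewrite sqrE.
rewrite integral_sum//; last first.
  by move=> ij; apply: integrableZl => //; exact: (XXi ij.1 ij.2).
rewrite (eq_bigr (fun ij =>
    (x ij.1 ord0 * x ij.2 ord0 * (1%:M : 'M[R]_d) ij.1 ij.2)%:E)); last first.
  move=> ij _; rewrite integralZl//.
  by rewrite XX EFinM.
rewrite sumEFin l2norm_sqr; congr (_%:E).
rewrite -(pair_bigA _ (fun i j => x i ord0 * x j ord0 * (1%:M : 'M[R]_d) i j)) /=.
apply: eq_bigr => i _; rewrite (bigD1 i)//= mxE eqxx mulr1 big1 ?addr0// => j ji.
by rewrite mxE eq_sym (negbTE ji) mulr0.
Qed.

End isotropic_vectors.

(** * Exponential moments of [|A x|^2] in the two models *)

Section sub_gaussian_models.
Context {R : realType} dO (Omega : measurableType dO) (P : probability Omega R).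

Lemma measurable_rand_row m n (A : Omega -> 'M[R]_(m, n)) i :
  random_matrix A -> measurable_fun [set: Omega] (rand_row A i).
Proof.
move=> mA; apply: measurable_fun_cV => j.
by under eq_fun do rewrite /rand_row !mxE; exact: mA.
Qed.

Lemma measurable_rand_col m n (A : Omega -> 'M[R]_(m, n)) j :
  random_matrix A -> measurable_fun [set: Omega] (rand_col A j).
Proof.
move=> mA; apply: measurable_fun_cV => i.
by under eq_fun do rewrite /rand_col !mxE; exact: mA.
Qed.

Lemma row_model_mgf m n (A : Omega -> 'M[R]_(m, n)) (x : 'cV[R]_n) (a t : R) :
  0 < a -> `|t| <= a / 2 -> random_matrix A ->
  mutually_independent P (rand_row A) ->
  (forall i, \int[P]_w (dot (rand_row A i w) x ^+ 2)%:E = 1)%E ->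
  (forall i, \int[P]_w (expR (a * dot (rand_row A i w) x ^+ 2))%:E <= 2%:E)%E ->
  (\int[P]_w (expR (t * (l2norm (A w *m x) ^+ 2 - m%:R)))%:E <=
   (expR (m%:R * (16 * expR a / a ^+ 2 * t ^+ 2)))%:E)%E.
Proof.
move=> a0 ta mA indA iso1 exp2; set b := 16 * _ / _ * _.
pose X : nat -> Omega -> 'cV[R]_n := nat_ext (cst 0) (rand_row A).
have mX j : measurable_fun [set: Omega] (X j).
  by apply: measurable_nat_ext => i; exact: measurable_rand_row.
pose g (j : nat) (sv : R * 'cV[R]_n) : R := sv.1 + dot sv.2 x ^+ 2.
have mg j : measurable_fun [set: R * 'cV[R]_n] (g j).
  apply: measurable_funD; first exact: measurable_fst.
  apply: measurable_funX.
  exact: (measurableT_comp (measurable_dot x) measurable_snd).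
(* Each step costs a factor [e^b]; [(m - l) b] is the budget for the remaining rows. *)
pose V (l : nat) (s : R) := (expR (t * (s - l%:R) + (m%:R - l%:R) * b))%:E.
have chainE l w : chain X g 0 l w = \sum_(0 <= j < l) dot (X j w) x ^+ 2.
  by elim: l => [|l IH]; [rewrite big_geq|rewrite big_nat_recr//= -IH].
have <- : V 0%N 0 = (expR (m%:R * b))%:E.
  by rewrite /V !subr0 mulr0 add0r.
have <- : (\int[P]_w V m (chain X g 0%R m w) =
    \int[P]_w (expR (t * (l2norm (A w *m x) ^+ 2 - m%:R)))%:E)%E.
  apply: eq_integral => w _; rewrite /V chainE subrr mul0r addr0.
  rewrite l2norm_sqr big_mkord; do 3 congr (_ _); congr (_ - _).
  apply: eq_bigr => i _; rewrite /X nat_extE mxE; congr (_ ^+ 2).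
  by apply: eq_bigr => j _; rewrite !mxE.
apply: (chain_supermartingale (V := V) (0 : R) mX mg (mutually_independent_nat indA)).
- move=> l; apply/measurable_EFinP; apply: measurableT_comp => //.
  apply: measurable_funD => //; apply: measurable_funM => //.
  exact: measurable_funB.
- by move=> l s; rewrite lee_fin expR_ge0.
- move=> l s lm; rewrite /X (nat_ext_lt _ _ lm); set i := Ordinal lm.
  set c := t * (s - l%:R) + (m%:R - l.+1%:R) * b.
  under eq_integral => w _.
    rewrite /V /g /= (_ : _ + _ = c + t * (dot (rand_row A i w) x ^+ 2 - 1)); last first.
      by rewrite /c -natr1; ring.
    rewrite expRD EFinM; over.
  have mdot : measurable_fun [set: Omega] (fun w => dot (rand_row A i w) x).
    exact: (measurableT_comp (measurable_dot x) (@measurable_rand_row _ _ A i mA)).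
  rewrite ge0_integralZl ?lee_fin ?expR_ge0//; last first.
    apply/measurable_EFinP; apply: measurableT_comp => //.
    apply: measurable_funM => //; apply: measurable_funB => //.
    exact: measurable_funX.
  have := centered_sqr_mgf a0 ta mdot (iso1 i) (exp2 i); rewrite -/b => H.
  apply: (@le_trans _ _ ((expR c)%:E * (expR b)%:E)%E).
    by rewrite lee_pmul2l// lte_fin expR_gt0.
  by rewrite -EFinM -expRD /V lee_fin ler_expR /c -natr1; lra.
Qed.

Lemma dotC d (x y : 'cV[R]_d) : dot x y = dot y x.
Proof. by apply: eq_bigr => i _; rewrite mulrC. Qed.

Lemma l2norm_eq0 d (x : 'cV[R]_d) : l2norm x = 0 -> x = 0.
Proof.
move=> x0; have := l2norm_sqr x; rewrite x0 expr0n /= => /esym/eqP.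
rewrite psumr_eq0 => [/allP H|i _]; last exact: sqr_ge0.
apply/matrixP => i j; rewrite ord1 mxE; apply/eqP.
by rewrite -sqrf_eq0; apply: (implyP (H i _)); rewrite ?mem_index_enum.
Qed.

Lemma dotZ d (c : R) (x y : 'cV[R]_d) : dot x (c *: y) = c * dot x y.
Proof. by rewrite /dot mulr_sumr; apply: eq_bigr => i _; rewrite mxE mulrCA. Qed.

Lemma l2norm_normalize d (x : 'cV[R]_d) : x != 0 ->
  l2norm ((l2norm x)^-1 *: x) = 1.
Proof.
move=> x0; have n0 : l2norm x != 0 by apply: contra_neq x0; exact: l2norm_eq0.
apply/eqP; rewrite -(@eqrXn2 _ 2)//; last exact: sqrtr_ge0.
by rewrite l2normZ expr1n exprVn mulVf// sqrf_eq0.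
Qed.

Lemma dot_mgf d (X : Omega -> 'cV[R]_d) (a c : R) (v : 'cV[R]_d) : 0 < a ->
  measurable_fun [set: Omega] X ->
  (forall u, l2norm u = 1%R ->
    \int[P]_w (expR (a * dot (X w) u ^+ 2))%:E <= 2%:E)%E ->
  (\int[P]_w (expR (c * dot (X w) v))%:E <=
   (2 * expR (c ^+ 2 * l2norm v ^+ 2 / (4 * a)))%:E)%E.
Proof.
move=> a0 mX exp2; have [->|v0] := eqVneq v 0.
  have dot0 w : dot (X w) 0 = 0 by rewrite /dot big1// => i _; rewrite mxE mulr0.
  under eq_integral do rewrite dot0 mulr0 expR0.
  rewrite integral_cst//= probability_setT mule1 lee_fin.
  have -> : l2norm (0 : 'cV[R]_d) ^+ 2 = 0.
    by rewrite l2norm_sqr big1// => i _; rewrite mxE expr0n.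
  by rewrite mulr0 mul0r expR0 mulr1 ler1n.
have n0 : l2norm v != 0 by apply: contra_neq v0; exact: l2norm_eq0.
set u := (l2norm v)^-1 *: v.
have vE : v = l2norm v *: u by rewrite scalerA mulfV// scale1r.
have -> : c ^+ 2 * l2norm v ^+ 2 = (c * l2norm v) ^+ 2 by rewrite exprMn.
under eq_integral do rewrite [in dot _ _]vE dotZ mulrA.
apply: exp_sqr_mgf => //; last exact: exp2 (l2norm_normalize v0).
exact: (measurableT_comp (measurable_dot u) mX).
Qed.

(* The exponent is allowed to grow slightly along the partial sums, so that each
   quadratic correction [theta^2 x_j^2 |y|^2 / a] produced by the moment
   generating function of <A_j, y> is absorbed by the change of exponent. *)
Lemma column_model_mgf m n (A : Omega -> 'M[R]_(m, n)) (x : 'cV[R]_n)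
    (a D t : R) :
  0 < a -> 4 / a <= D -> `|t| <= D^-1 -> l2norm x = 1 -> random_matrix A ->
  mutually_independent P (rand_col A) ->
  (forall j, {ae P, forall w, l2norm (rand_col A j w) = Num.sqrt m%:R}) ->
  (forall j u, l2norm u = 1%R ->
    \int[P]_w (expR (a * dot (rand_col A j w) u ^+ 2))%:E <= 2%:E)%E ->
  (\int[P]_w (expR (t * (l2norm (A w *m x) ^+ 2 - m%:R)))%:E <=
   (expR (m%:R * (D * t ^+ 2) + #|supp x|%:R))%:E)%E.
Proof.
move=> a0 aD tD x1 mA indA normA exp2.
have D0 : 0 < D by apply: lt_le_trans aD; rewrite divr_gt0.
pose X : nat -> Omega -> 'cV[R]_m := nat_ext (cst 0) (rand_col A).
have mX j : measurable_fun [set: Omega] (X j).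
  by apply: measurable_nat_ext => i; exact: measurable_rand_col.
pose xn := nat_ext 0 (fun i => x i ord0).
pose g (j : nat) (yv : 'cV[R]_m * 'cV[R]_m) : 'cV[R]_m := yv.1 + xn j *: yv.2.
have mg j : measurable_fun [set: 'cV[R]_m * 'cV[R]_m] (g j).
  apply: measurable_fun_cV => i; under eq_fun do rewrite /g !mxE.
  apply: measurable_funD.
    exact: (measurableT_comp (measurable_coord i) measurable_fst).
  apply: measurable_funM => //.
  exact: (measurableT_comp (measurable_coord i) measurable_snd).
pose s l := \sum_(0 <= j < l) xn j ^+ 2.
have sE : s n = 1.
  rewrite /s big_mkord -[RHS](expr1n _ 2) -x1 l2norm_sqr.
  by apply: eq_bigr => i _; rewrite /xn nat_extE.
have s01 l : (l <= n)%N -> 0 <= s l <= 1.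
  move=> ln; apply/andP; split; first by apply: sumr_ge0 => i _; exact: sqr_ge0.
  rewrite -sE /s (@big_cat_nat _ _ _ l 0 n)//= lerDl.
  by apply: sumr_ge0 => i _; exact: sqr_ge0.
(* One step lowers the exponent by [D t^2 x_l^2], and it ends at [th n = t] because [s n = 1]. *)
pose th l := t + D * t ^+ 2 * (1 - s l).
have Dt : D * t ^+ 2 <= `|t|.
  rewrite -real_normK ?num_real// expr2 mulrA ler_piMl//.
  by rewrite -ler_pdivlMl// mulr1.
have Dt0 : 0 <= D * t ^+ 2 by rewrite mulr_ge0 ?sqr_ge0// ltW.
(* Here [|th l| <= |t| + D t^2 <= 2 |t|], and [4 / a <= D]. *)
have th_sqr l : (l <= n)%N -> th l ^+ 2 / a <= D * t ^+ 2.
  move=> /s01/andP[s0 s1].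
  have h : th l ^+ 2 <= 4 * t ^+ 2.
    have -> : 4 * t ^+ 2 = (2 * `|t|) ^+ 2 by rewrite exprMn real_normK ?num_real//; ring.
    rewrite -[leLHS]real_normK ?num_real// ler_pXn2r ?nnegrE ?mulr_ge0//.
    rewrite (le_trans (ler_normD _ _))// mulr_natl mulr2n lerD2l.
    rewrite ger0_norm; last by apply: mulr_ge0; rewrite ?subr_ge0.
    apply: le_trans Dt.
    by rewrite ler_piMr// gerBl.
  apply: (@le_trans _ _ (4 / a * t ^+ 2)); last by rewrite ler_wpM2r ?sqr_ge0.
  by rewrite [leRHS]mulrAC ler_wpM2r// invr_ge0 ltW.
(* Prepays, for the columns still to come, the terms [m x_j^2] and one factor [e >= 2] per nonzero
   coordinate. *)
pose rest l := \sum_(l <= j < n) (m%:R * (th j.+1 * xn j ^+ 2) + (xn j != 0)%:R).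
pose V (l : nat) (y : 'cV[R]_m) :=
  (expR (th l * l2norm y ^+ 2 + rest l - t * m%:R))%:E.
have chainE l w : chain X g 0 l w = \sum_(0 <= j < l) xn j *: X j w.
  by elim: l => [|l IH]; [rewrite big_geq|rewrite big_nat_recr//= -IH].
have <- : (\int[P]_w V n (chain X g 0%R n w) =
    \int[P]_w (expR (t * (l2norm (A w *m x) ^+ 2 - m%:R)))%:E)%E.
  have rest_n : rest n = 0 by rewrite /rest big_geq.
  apply: eq_integral => w _; rewrite /V chainE rest_n addr0 /th sE.
  suff -> : \sum_(0 <= j < n) xn j *: X j w = A w *m x.
    by rewrite subrr mulr0 addr0 mulrBr.
  apply/matrixP => i j; rewrite ord1 big_mkord summxE mxE.
  by apply: eq_bigr => l _; rewrite !mxE /xn /X !nat_extE !mxE mulrC.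
apply: (@le_trans _ _ (V 0%N 0)); last first.
  rewrite /V lee_fin ler_expR.
  have -> : l2norm (0 : 'cV[R]_m) ^+ 2 = 0.
    by rewrite l2norm_sqr big1// => i _; rewrite mxE expr0n.
  rewrite mulr0 add0r /rest big_split/= -mulr_sumr addrAC.
  apply: lerD; last first.
    rewrite big_mkord -natr_sum ler_nat -sum1_card [leqRHS]big_mkcond/= leq_sum// => i _.
    by rewrite /xn nat_extE inE; case: eqP.
  (* Since [th (j + 1) <= t + D t^2] and the [x_j^2] sum to 1, what remains after subtracting [t m]
     is at most [m D t^2]. *)
  rewrite [t * _]mulrC -mulrBr ler_wpM2l// lerBlDr.
  apply: (@le_trans _ _ (\sum_(0 <= j < n) (D * t ^+ 2 + t) * xn j ^+ 2)).
    apply: ler_sum_nat => j /andP[_ jn]; rewrite ler_wpM2r ?sqr_ge0// /th addrC lerD2r.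
    by have /andP[s0 _] := s01 _ jn; rewrite ler_piMr// gerBl.
  by rewrite -mulr_sumr -/(s n) sE mulr1.
apply: (chain_supermartingale (V := V) (0 : 'cV[R]_m) mX mg (mutually_independent_nat indA)).
- move=> l; apply/measurable_EFinP; apply: measurableT_comp => //.
  apply: measurable_funB => //; apply: measurable_funD => //.
  by apply: measurable_funM => //; exact: measurable_l2norm_sqr.
- by move=> l y; rewrite lee_fin expR_ge0.
- move=> l y ln; rewrite /X (nat_ext_lt _ _ ln); set i := Ordinal ln.
  have restE : rest l = m%:R * (th l.+1 * xn l ^+ 2) + (xn l != 0)%:R + rest l.+1.
    by rewrite /rest big_ltn.
  have thE : th l = th l.+1 + D * t ^+ 2 * xn l ^+ 2.
    by rewrite /th /s big_nat_recr//=; ring.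
  have mcol := @measurable_rand_col _ _ A i mA.
  set b := 2 * th l.+1 * xn l.
  set c := th l.+1 * l2norm y ^+ 2 + m%:R * (th l.+1 * xn l ^+ 2) + rest l.+1 - t * m%:R.
  have mdot : measurable_fun [set: Omega] (fun w => expR (b * dot (rand_col A i w) y)).
    apply: measurableT_comp => //; apply: measurable_funM => //.
    exact: (measurableT_comp (measurable_dot y) mcol).
  rewrite (@ge0_ae_eq_integral _ _ _ _ _ _
      (fun w => (expR c)%:E * (expR (b * dot (rand_col A i w) y))%:E)%E)//; last 4 first.
  + apply/measurable_EFinP; apply: measurableT_comp => //.
    apply: measurable_funB => //; apply: measurable_funD => //.
    apply: measurable_funM => //; apply: (measurableT_comp measurable_l2norm_sqr).
    apply: (measurableT_comp (mg l)); exact: measurable_fun_pair.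
  + by apply: emeasurable_funM => //; apply/measurable_EFinP.
  + by move=> w _; rewrite lee_fin expR_ge0.
  + apply: filterS (normA i) => w nw _; rewrite /V /g /= -EFinM -expRD.
    have -> : y + xn l *: rand_col A i w = 1 *: y + xn l *: rand_col A i w by rewrite scale1r.
    have nw2 : l2norm (rand_col A i w) ^+ 2 = m%:R by rewrite nw sqr_sqrtr.
    by rewrite l2norm_lincomb nw2 dotC /c /b; do 2 congr (_ _); ring.
  rewrite ge0_integralZl ?lee_fin ?expR_ge0//; last exact/measurable_EFinP.
  (* A zero coordinate leaves the state unchanged and must not cost the factor 2. *)
  rewrite /V restE thE; have [xl0|xl0] := eqVneq (xn l) 0.
    rewrite /b xl0 mulr0; under eq_integral do rewrite mul0r expR0.
    rewrite integral_cst//= probability_setT !mule1 lee_fin ler_expR /c xl0.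
    by rewrite expr0n /= !mulr0 !addr0 add0r.
  have := dot_mgf b y a0 mcol (exp2 i) => H.
  apply: (@le_trans _ _ ((expR c)%:E * (2 * expR (b ^+ 2 * l2norm y ^+ 2 / (4 * a)))%:E)%E).
    by rewrite lee_pmul2l// lte_fin expR_gt0.
  rewrite -EFinM lee_fin.
  have e2 : 2 <= expR 1 :> R by have := expR_ge1Dx (1 : R); lra.
  apply: (@le_trans _ _ (expR c * (expR 1 * expR (b ^+ 2 * l2norm y ^+ 2 / (4 * a))))).
    by rewrite ler_wpM2l ?expR_ge0// ler_wpM2r ?expR_ge0.
  rewrite -!expRD ler_expR /c /=.
  have -> : b ^+ 2 * l2norm y ^+ 2 / (4 * a) =
      (th l.+1 ^+ 2 / a) * xn l ^+ 2 * l2norm y ^+ 2.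
    by rewrite /b; field; rewrite gt_eqF.
  have : th l.+1 ^+ 2 / a * xn l ^+ 2 * l2norm y ^+ 2 <=
      D * t ^+ 2 * xn l ^+ 2 * l2norm y ^+ 2.
    by do 2 (rewrite ler_wpM2r ?sqr_ge0//); exact: th_sqr.
  lra.
Qed.

End sub_gaussian_models.

(** * Cardinality of the net *)

Section net_count.
Context {R : realType}.

(** A finite type of codes for bounded integers. As [Negz j] is [-(j + 1)], zero has a single
    code. *)
Definition code_int {N} (c : bool * 'I_N) : int :=
  if c.1 then Posz c.2 else Negz c.2.

Lemma code_int_surj N (z : int) : (`|z| <= N)%N ->
  exists c : bool * 'I_N.+1, code_int c = z.
Proof.
case: z => [j|j] /= jN.
  by exists (true, inord j); rewrite /code_int /= inordK.
by exists (false, inord j); rewrite /code_int /= inordK// ltnS ltnW.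
Qed.

Definition in_net {n N} (k : R) (f : {ffun 'I_n -> bool * 'I_N}) : bool :=
  (#|supp (grid_vec (code_int \o f) : 'cV[R]_n)|%:R <= k) &&
  ((\sum_i `|code_int (f i)|)%N%:R <= 4 * k).

(** Charges [y] for a nonzero coordinate and a factor 1/2 per unit of size; the geometric series
    keep the total at most [1 + 2 y]. *)
Let weight (y : R) (z : int) : R := if z == 0 then 1 else y / 2 ^+ `|z|.

Let sum_weight (y : R) N : 0 <= y ->
  \sum_(c : bool * 'I_N.+1) weight y (code_int c) <= 1 + 2 * y.
Proof.
move=> y0.
have geo M : \sum_(j < M) y / 2 ^+ j.+1 <= y.
  have -> : \sum_(j < M) y / 2 ^+ j.+1 = y - y / 2 ^+ M.
    elim: M => [|M IH]; first by rewrite big_ord0 expr0 divr1 subrr.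
    rewrite big_ord_recr /= IH exprS; field.
    by rewrite expf_neq0.
  by rewrite gerBl divr_ge0// exprn_ge0.
rewrite -(pair_bigA _ (fun b j => weight y (code_int (b, j)))) /= big_bool /=.
rewrite big_ord_recl /= /weight /code_int /= -!addrA lerD2l mulr_natl mulr2n.
by apply: lerD; exact: geo.
Qed.

(** With [y = k / n] each net vector has product weight at least [y^k e^(-4 k)], while all vectors
    together weigh at most [(1 + 2 y)^n <= e^(2 k)]. *)
Lemma net_card n N (k : R) : 0 < k -> k <= n%:R ->
  #|[pred f : {ffun 'I_n -> bool * 'I_N.+1} | in_net k f]|%:R <=
  expR (6 * k + k * ln (n%:R / k)).
Proof.
move=> k0 kn; have n0 : 0 < n%:R :> R by apply: lt_le_trans kn.
pose y := k / n%:R; have y0 : 0 < y by rewrite divr_gt0.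
have y1 : y <= 1 by rewrite ler_pdivrMr// mul1r.
have lny : ln (n%:R / k) = - ln y by rewrite -lnV ?posrE// invf_div.
have lny0 : ln y <= 0 by rewrite -ln1 ler_ln ?posrE.
pose low := expR (k * ln y - 4 * k).
have lowW (f : {ffun 'I_n -> bool * 'I_N.+1}) : in_net k f ->
    low <= \prod_i weight y (code_int (f i)).
  move=> /andP[suppk sumk].
  have W z : expR ((z != 0)%:R * ln y - `|z|%N%:R) <= weight y z.
    rewrite /weight; case: eqP => [->|_] /=; first by rewrite mul0r subr0 expR0.
    rewrite mul1r expRD lnK ?posrE// ler_wpM2l ?(ltW y0)// expRN.
    rewrite lef_pV2 ?posrE ?expR_gt0 ?exprn_gt0//.
    rewrite -[X in expR X]mulr1 expRM_natl lerXn2r ?nnegrE ?expR_ge0//.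
    by have := expR_ge1Dx (1 : R); lra.
  apply: (@le_trans _ _ (\prod_i
      expR ((code_int (f i) != 0)%:R * ln y - `|code_int (f i)|%N%:R))).
    rewrite -expR_sum ler_expR big_split /= sumrN -natr_sum -mulr_suml.
    apply: lerD; last by rewrite lerN2.
    rewrite -natr_sum; have -> : (\sum_i (code_int (f i) != 0) =
        #|supp (grid_vec (code_int \o f) : 'cV[R]_n)|)%N.
      rewrite -sum1_card [RHS]big_mkcond/=; apply: eq_bigr => i _.
      by rewrite inE mxE /= intr_eq0; case: eqP.
    by rewrite ler_wnM2r.
  by apply: ler_prod => i _; rewrite expR_ge0/=.
have : #|[pred f : {ffun 'I_n -> bool * 'I_N.+1} | in_net k f]|%:R * low <= expR (2 * k).
  apply: (@le_trans _ _ (\sum_(f : {ffun 'I_n -> bool * 'I_N.+1})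
      \prod_i weight y (code_int (f i)))).
    rewrite mulr_natl -sumr_const big_mkcond/=; apply: ler_sum => f _.
    rewrite inE; case: ifPn => [/lowW//|_]; apply: prodr_ge0 => i _.
    by rewrite /weight; case: ifP => // _; rewrite divr_ge0 ?exprn_ge0// ltW.
  (* Distributivity: the sum over functions of products is the [n]-th power of a one-coordinate
     sum. *)
  rewrite -(bigA_distr_bigA (fun i c => weight y (code_int c))) prodr_const card_ord.
  have -> : 2 * k = n%:R * (2 * y) by rewrite /y; field; rewrite gt_eqF.
  rewrite expRM_natl lerXn2r ?nnegrE ?expR_ge0//.
    apply: sumr_ge0 => c _; rewrite /weight; case: ifP => // _.
    by rewrite divr_ge0 ?exprn_ge0// ltW.
  by apply: le_trans (sum_weight N (ltW y0)) (expR_ge1Dx _).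
rewrite -ler_pdivlMr ?expR_gt0// => H; apply: (le_trans H).
by rewrite -expRN -expRD ler_expR lny; lra.
Qed.

End net_count.

(** * Union bound *)

Section union_bound.
Context {R : realType} dO (Omega : measurableType dO) (P : probability Omega R).

Lemma measurable_level (f : Omega -> R) (c : R) :
  measurable_fun [set: Omega] f -> measurable [set w | c <= f w].
Proof.
move=> mf; have := mf measurableT `[c, +oo[%classic (measurable_itv _).
by rewrite setTI; congr measurable; apply/seteqP; split => w /=;
  rewrite in_itv/= andbT.
Qed.

Lemma measurable_strict_level (f : Omega -> R) (c : R) :
  measurable_fun [set: Omega] f -> measurable [set w | c < f w].
Proof.
move=> mf; have := mf measurableT `]c, +oo[%classic (measurable_itv _).
by rewrite setTI; congr measurable; apply/seteqP; split => w /=;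
  rewrite in_itv/= andbT.
Qed.

Lemma exp_markov (Y : Omega -> R) (b c : R) : measurable_fun [set: Omega] Y ->
  (\int[P]_w (expR (Y w))%:E <= (expR b)%:E)%E ->
  (P [set w | c <= Y w]%R <= (expR (b - c))%:E)%E.
Proof.
move=> mY Yb; set E := [set w | _]; have mE : measurable E by exact: measurable_level.
have : ((expR c)%:E * P E <= (expR b)%:E)%E.
  apply: le_trans Yb; rewrite -[P E](_ : \int[P]_w (\1_E w)%:E = _)%E; last first.
    by rewrite integral_indic// setIT.
  rewrite -ge0_integralZl ?lee_fin ?expR_ge0//; last first.
    by apply/measurable_EFinP; exact: measurable_indic.
  apply: ge0_le_integral => //.
  - by apply: emeasurable_funM => //; apply/measurable_EFinP; exact: measurable_indic.
  - by apply/measurable_EFinP; exact: measurableT_comp.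
  - move=> w _; rewrite -EFinM lee_fin indicE; have [wE|_] := boolP (w \in E).
      by rewrite mulr1 ler_expR; move: wE; rewrite inE.
    by rewrite mulr0 expR_ge0.
by rewrite muleC -lee_pdivlMr ?expR_gt0// -EFinM expRB.
Qed.

Lemma measurable_mulmx_l2norm m n (A : Omega -> 'M[R]_(m, n)) (x : 'cV[R]_n) :
  random_matrix A -> measurable_fun [set: Omega] (fun w => l2norm (A w *m x) ^+ 2).
Proof.
move=> mA; apply: (measurableT_comp measurable_l2norm_sqr).
apply: measurable_fun_cV => i; under eq_fun do rewrite mxE.
by apply: measurable_sum => j; apply: measurable_funM => //; exact: mA.
Qed.

Lemma measurable_defect m n (A : Omega -> 'M[R]_(m, n)) (x : 'cV[R]_n) :
  random_matrix A -> measurable_fun [set: Omega] (fun w => `|defect (A w) x|).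
Proof.
move=> mA; apply: measurableT_comp => //; apply: measurable_funB => //.
exact: measurable_mulmx_l2norm.
Qed.

Lemma random_matrixZ m n (A : Omega -> 'M[R]_(m, n)) (c : R) :
  random_matrix A -> random_matrix (fun w => c *: A w).
Proof.
by move=> mA i j; under eq_fun do rewrite mxE; apply: measurable_funM => //; exact: mA.
Qed.

(** By [ric_le_gridP] the complement is a countable union of events indexed by integer vectors. *)
Lemma measurable_ric m n (A : Omega -> 'M[R]_(m, n)) (k delta : R) :
  random_matrix A -> 0 <= delta -> measurable [set w | ric k (A w) <= delta].
Proof.
move=> mA d0.
have -> : [set w | ric k (A w) <= delta] =
    ~` \bigcup_(z : {ffun 'I_n -> int}) [set w |
      #|supp (grid_vec z : 'cV[R]_n)|%:R <= k /\
      delta * l2norm (grid_vec z : 'cV[R]_n) ^+ 2 < `|defect (A w) (grid_vec z)|].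
  apply/seteqP; split => w /=.
    by move=> /(ric_le_gridP k (A w) d0) H [z _ [kz]]; rewrite ltNge H.
  move=> H; apply/(ric_le_gridP k (A w) d0) => z kz; rewrite leNgt; apply/negP => ltz.
  by apply: H; exists z.
apply: measurableC; apply: countable_bigcupT_measurable => [|z].
  exact: countableP.
have [kz|kz] := boolP (#|supp (grid_vec z : 'cV[R]_n)|%:R <= k); last first.
  by rewrite (_ : [set w | _] = set0)//; apply/seteqP; split => w //= [].
rewrite (_ : [set w | _] = [set w |
    delta * l2norm (grid_vec z : 'cV[R]_n) ^+ 2 < `|defect (A w) (grid_vec z)|]).
  exact/measurable_strict_level/measurable_defect.
by apply/seteqP; split => w /= => [[]//|].
Qed.

(** Estimate (1), the interface through which both models enter the union bound. *)
Definition mgf_bound {m n} (A : Omega -> 'M[R]_(m, n)) (D : R) :=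
  forall (x : 'cV[R]_n) (t : R), l2norm x = 1 -> `|t| <= D^-1 ->
  (\int[P]_w (expR (t * (l2norm (A w *m x) ^+ 2 - m%:R)))%:E <=
   (expR (m%:R * (D * t ^+ 2) + #|supp x|%:R))%:E)%E.

Lemma defect_tail m n (A : Omega -> 'M[R]_(m, n)) (D delta : R) (x : 'cV[R]_n) :
  random_matrix A -> (0 < m)%N -> 0 < D -> 0 < delta -> delta < 1 ->
  mgf_bound A D -> x != 0 ->
  (P [set w | delta / 2 * l2norm x ^+ 2 < `|defect ((Num.sqrt m%:R)^-1 *: A w) x|]%R <=
   (2 * expR (#|supp x|%:R - delta ^+ 2 * m%:R / (16 * D)))%:E)%E.
Proof.
move=> mA m0 D0 d0 d1 mgfA x0; have mR : 0 < m%:R :> R by rewrite ltr0n.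
set u := (l2norm x)^-1 *: x.
have n0 : l2norm x != 0 by apply: contra_neq x0; exact: l2norm_eq0.
have u1 : l2norm u = 1 by exact: l2norm_normalize.
have supp_u : supp u = supp x.
  by apply/setP => i; rewrite !inE mxE mulf_eq0 invr_eq0 (negbTE n0).
have X0 : 0 < l2norm x ^+ 2 by rewrite exprn_even_gt0.
pose Y w := l2norm (A w *m u) ^+ 2 - m%:R.
have mY : measurable_fun [set: Omega] Y.
  by apply: measurable_funB => //; exact: measurable_mulmx_l2norm.
have defectE w : defect ((Num.sqrt m%:R)^-1 *: A w) x = l2norm x ^+ 2 * (Y w / m%:R).
  have {1}-> : x = l2norm x *: u by rewrite scalerA mulfV// scale1r.
  rewrite defectZ /defect u1 expr1n -scalemxAl l2normZ exprVn (sqr_sqrtr (ler0n R m)).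
  by rewrite /Y; field; rewrite gt_eqF.
(* The minimizer of [m D t^2 - t m delta / 2], with value [- delta^2 m / (16 D)]. *)
pose t := delta / (4 * D); have t0 : 0 <= t by rewrite divr_ge0 ?mulr_ge0// ltW.
have tD : t <= D^-1.
  by rewrite /t invfM mulrA ler_piMl ?invr_ge0 ?(ltW D0)//; lra.
pose c := delta ^+ 2 * m%:R / (8 * D).
have tail e : `|e| = 1 -> (P [set w | c <= (e * t) * Y w]%R <=
    (expR (#|supp x|%:R - delta ^+ 2 * m%:R / (16 * D)))%:E)%E.
  move=> e1; have -> : #|supp x|%:R - delta ^+ 2 * m%:R / (16 * D) =
      m%:R * (D * (e * t) ^+ 2) + #|supp u|%:R - c.
    have -> : (e * t) ^+ 2 = t ^+ 2.
      rewrite -[LHS]real_normK ?num_real// normrM e1 mul1r.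
      by rewrite real_normK ?num_real.
    by rewrite supp_u /c /t; field; rewrite gt_eqF.
  apply: exp_markov; first by apply: measurable_funM => //; exact: measurable_cst.
  by apply: mgfA => //; rewrite normrM e1 mul1r ger0_norm.
have sub : [set w | delta / 2 * l2norm x ^+ 2 < `|defect ((Num.sqrt m%:R)^-1 *: A w) x|] `<=`
    [set w | c <= (1 * t) * Y w] `|` [set w | c <= (-1 * t) * Y w].
  move=> w /=; rewrite defectE normrM (gtr0_norm X0) mulrC ltr_pM2l// => h.
  have {}h : delta / 2 * m%:R < `|Y w|.
    by move: h; rewrite normf_div (gtr0_norm mR) ltr_pdivlMr.
  have hc : c <= t * `|Y w|.
    have -> : c = t * (delta / 2 * m%:R) by rewrite /c /t; field; rewrite gt_eqF.
    by rewrite ler_wpM2l// ltW.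
  have [Y0|Y0] := leP 0 (Y w).
    by left; rewrite /= mul1r -(ger0_norm Y0).
  by right; rewrite /= mulN1r mulNr -mulrN -(ltr0_norm Y0).
have mlev e : measurable [set w | c <= (e * t) * Y w].
  by apply: measurable_level; apply: measurable_funM => //; exact: measurable_cst.
apply: (@le_trans _ _
    (P ([set w | c <= (1 * t) * Y w]%R `|` [set w | c <= (-1 * t) * Y w]%R))).
  apply: le_measure => //; rewrite inE; last by apply: measurableU; exact: mlev.
  exact/measurable_strict_level/measurable_defect/random_matrixZ.
apply: (le_trans (measureU2 _ (mlev 1) (mlev (-1)))).
rewrite mulr_natl mulr2n EFinD; apply: leeD; apply: tail; first exact: normr1.
exact: normrN1.
Qed.

Lemma measure_bigsetU_le (I : finType) (Q : pred I) (F : I -> set Omega) :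
  (forall i, measurable (F i)) ->
  (P (\big[setU/set0]_(i | Q i) F i) <= \sum_(i | Q i) P (F i))%E.
Proof.
move=> mF.
suff [] : measurable (\big[setU/set0]_(i | Q i) F i) /\
  (P (\big[setU/set0]_(i | Q i) F i) <= \sum_(i | Q i) P (F i))%E by [].
elim/big_rec2 : _ => [|i y A _ [mA le]]; first by rewrite measure0.
split; first exact: measurableU.
by apply: (le_trans (measureU2 _ (mF i) mA)); apply: leeD.
Qed.

(** The union bound has exponent at most [7 (k + k ln(n/k)) - e]. As [224 = 7 * 32], the assumption
    on [m] bounds the first part by [e / 2], leaving [- e / 2]. *)
Lemma ric_tail m n (A : Omega -> 'M[R]_(m, n)) (D k delta : R) :
  random_matrix A -> (0 < m)%N -> 0 < D -> 0 < delta -> delta < 1 ->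
  1 <= k -> k <= n%:R -> mgf_bound A D ->
  224 * D * delta ^- 2 * k * ln (expR 1 * n%:R / k) <= m%:R ->
  ((1 - 2 * expR (- ((32 * D)^-1 * delta ^+ 2 * m%:R)))%:E <=
     P [set w | ric k ((Num.sqrt m%:R)^-1 *: A w) <= delta]%R)%E.
Proof.
move=> mA m0 D0 d0 d1 k1 kn mgfA Hm.
have k0 : 0 < k by apply: lt_le_trans k1.
have n0 : 0 < n%:R :> R by apply: lt_le_trans kn.
pose B w := (Num.sqrt m%:R)^-1 *: A w.
have mB : random_matrix B by exact: random_matrixZ.
pose N := Num.truncn (4 * k).
pose vec (f : {ffun 'I_n -> bool * 'I_N.+1}) : 'cV[R]_n := grid_vec (code_int \o f).
(* The zero vector has no defect, whereas [defect_tail] needs a direction. *)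
pose bad f := if vec f == 0 then set0 else
  [set w | delta / 2 * l2norm (vec f) ^+ 2 < `|defect (B w) (vec f)|].
have mbad f : measurable (bad f).
  rewrite /bad; case: ifP => // _.
  exact/measurable_strict_level/measurable_defect.
set S := [set w | _]; have mS : measurable S by apply: measurable_ric => //; exact: ltW.
have subS : ~` S `<=` \big[setU/set0]_(f | in_net k f) bad f.
  move=> w /= Sw; apply: contrapT => Hw; apply: Sw.
  rewrite /S /=; apply: ric_le_of_net; first exact: ltW.
  move=> z kz sz.
  have zN i : (`|z i| <= N)%N.
    rewrite /N truncn_ge_nat ?mulr_ge0 ?(ltW k0)//; apply: le_trans sz.
    by rewrite ler_nat (bigD1 i)//= leq_addr.
  have /choice[f fz] := fun i => code_int_surj (zN i).
  pose F : {ffun 'I_n -> bool * 'I_N.+1} := [ffun i => f i].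
  have Fz i : code_int (F i) = z i by rewrite ffunE fz.
  have vF : vec F = grid_vec z by apply/matrixP => i j; rewrite !mxE /= Fz.
  have netF : in_net k F.
    rewrite /in_net -/(vec F) vF kz /=.
    by under eq_bigr do rewrite Fz.
  rewrite leNgt; apply/negP => ltz; apply: Hw.
  rewrite -bigcup_seq_cond; exists F; first by rewrite /= mem_index_enum.
  rewrite /bad; case: eqP => [v0|_] /=; last by rewrite vF.
  exfalso; move: ltz; rewrite -vF v0.
  have -> : (0 : 'cV[R]_n) = 0 *: 0 by rewrite scale0r.
  by rewrite defectZ l2normZ expr0n /= !mul0r normr0 mulr0 ltxx.
set e := delta ^+ 2 * m%:R / (16 * D).
have PS : (P (~` S) <= (2 * expR (- ((32 * D)^-1 * delta ^+ 2 * m%:R)))%:E)%E.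
  apply: (@le_trans _ _ (P (\big[setU/set0]_(f | in_net k f) bad f))).
    apply: le_measure => //; rewrite inE; first exact: measurableC.
    by apply: bigsetU_measurable.
  apply: (le_trans (measure_bigsetU_le _ _)) => //.
  apply: (@le_trans _ _ (\sum_(f : {ffun 'I_n -> bool * 'I_N.+1} | in_net k f)
      (2 * expR (k - e))%:E)%E).
    apply: lee_sum => f /andP[kf _]; rewrite /bad; case: ifPn => [_|v0].
      by rewrite measure0 lee_fin mulr_ge0 ?expR_ge0.
    apply: (le_trans (defect_tail mA m0 D0 d0 d1 mgfA v0)).
    by rewrite lee_fin ler_wpM2l// ler_expR lerD2r.
  rewrite sumEFin lee_fin sumr_const -[leLHS]mulr_natl mulrCA ler_wpM2l//.
  apply: (@le_trans _ _ (expR (6 * k + k * ln (n%:R / k)) * expR (k - e))).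
    rewrite ler_wpM2r ?expR_ge0//; exact: net_card.
  rewrite -expRD ler_expR.
  have lnE : ln (expR 1 * n%:R / k) = 1 + ln (n%:R / k).
    by rewrite -mulrA lnM ?posrE ?expR_gt0 ?divr_gt0// expRK.
  have ln0 : 0 <= ln (n%:R / k) by rewrite ln_ge0// ler_pdivlMr// mul1r.
  have H : 7 * (k + k * ln (n%:R / k)) <= (32 * D)^-1 * delta ^+ 2 * m%:R.
    move: Hm; rewrite lnE => Hm.
    have := ler_wpM2l (_ : 0 <= (32 * D)^-1 * delta ^+ 2) Hm.
    have -> : (32 * D)^-1 * delta ^+ 2 * (224 * D * delta ^- 2 * k * (1 + ln (n%:R / k))) =
        7 * (k + k * ln (n%:R / k)).
      by field; rewrite !gt_eqF.
    by apply; rewrite mulr_ge0 ?sqr_ge0// invr_ge0 mulr_ge0// ltW.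
  have eE : e = 2 * ((32 * D)^-1 * delta ^+ 2 * m%:R).
    by rewrite /e; field; rewrite gt_eqF.
  have kl : 0 <= k * ln (n%:R / k) by rewrite mulr_ge0// ltW.
  by rewrite eE; lra.
have := probability_setC P mS.
have /fineK PSE : P S \is a fin_num by exact: fin_num_measure.
rewrite -PSE => PC; move: PS; rewrite PC -EFinB !lee_fin; lra.
Qed.

End union_bound.

(** * From the tail bound to the two models *)

Lemma psi2norm_vec_le (R : realType) d (Omega : measurableType d)
    (P : probability Omega R) n (X : Omega -> 'cV[R]_n) (K : \bar R) (u : 'cV[R]_n) :
  (psi2norm_vec P X <= K)%E -> l2norm u = 1 ->
  (psi2norm P (fun w => dot (X w) u) <= K)%E.
Proof. by move=> XK u1; apply: le_trans XK; apply: ereal_sup_ubound; exists u. Qed.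

Theorem theorem5p65 (R : realType) (K : R) :
  exists C c : R, 0 < C /\ 0 < c /\
    forall (m n : nat) (disp : measure_display) (Omega : measurableType disp)
      (P : probability Omega R) (A : Omega -> 'M[R]_(m, n)),
      (row_independent_model P A /\ max_row_psi2norm P A = K%:E) \/
      (column_independent_model P A /\ max_col_psi2norm P A = K%:E) ->
      forall k delta : R,
        1 <= k -> k <= n%:R -> 0 < delta -> delta < 1 ->
        C * delta ^- 2 * k * ln (expR 1 * n%:R / k) <= m%:R ->
        ((1 - 2 * expR (- (c * delta ^+ 2 * m%:R)))%:E <=
           P [set w | ric k ((Num.sqrt m%:R)^-1 *: A w) <= delta]%R)%E.
Proof.
(* [K] is an arbitrary real here; the maximum makes the parameter positive. *)
pose M := Num.max K 1; have M0 : 0 < M by rewrite lt_max ltr01 orbT.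
have KM : (K%:E <= M%:E)%E by rewrite lee_fin le_max lexx.
pose a := (4 * expR 1 * M ^+ 2)^-1.
have a0 : 0 < a by rewrite invr_gt0 !mulr_gt0 ?expR_gt0.
(* The first summand serves the rows, the second the columns; it also gives [1 / D <= a / 2]. *)
pose D := 16 * expR a / a ^+ 2 + 4 / a.
have D1 : 0 < 16 * expR a / a ^+ 2.
  by rewrite divr_gt0 ?exprn_gt0// mulr_gt0 ?expR_gt0.
have aD : 4 / a <= D by rewrite /D lerDr ltW.
have D0 : 0 < D by rewrite addr_gt0// divr_gt0.
exists (224 * D), ((32 * D)^-1); split; first by rewrite mulr_gt0.
split; first by rewrite invr_gt0 mulr_gt0.
move=> m n disp Omega P A model k delta k1 kn d0 d1 Hm.
have k0 : 0 < k by apply: lt_le_trans k1.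
(* The lower bound on [m] is positive because [e n / k > 1]. *)
have m0 : (0 < m)%N.
  rewrite -(ltr0n R); apply: lt_le_trans Hm; rewrite mulr_gt0 ?ln_gt0//.
    by rewrite !mulr_gt0// invr_gt0 exprn_gt0.
  rewrite ltr_pdivlMr// mul1r; apply: (le_lt_trans kn).
  by rewrite ltr_pMl ?expR_gt1// (lt_le_trans k0).
have exp2 d (X : Omega -> 'cV[R]_d) u : measurable_fun [set: Omega] X ->
    (psi2norm_vec P X <= K%:E)%E -> l2norm u = 1 ->
    (\int[P]_w (expR (a * dot (X w) u ^+ 2))%:E <= 2%:E)%E.
  move=> mX XK u1; apply: psi2norm_exp_sqr => //.
    exact: (measurableT_comp (measurable_dot u) mX).
  by apply: le_trans KM; exact: psi2norm_vec_le.
case: model => [[[mA indA _ isoA] maxK]|[[mA indA _ _ normA] maxK]].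
- apply: ric_tail => // x t x1 tD.
  have mrow i := @measurable_rand_row R _ Omega _ _ A i mA.
  have rowK i : (psi2norm_vec P (rand_row A i) <= K%:E)%E.
    by rewrite -maxK; exact: le_bigmax.
  have ta : `|t| <= a / 2.
    apply: (le_trans tD); rewrite -[a / 2]invrK lef_pV2 ?posrE ?invr_gt0 ?divr_gt0//.
    apply: le_trans aD; rewrite invf_div ler_pM2r; last by rewrite invr_gt0.
    by rewrite ler_nat.
  apply: (le_trans (row_model_mgf (x := x) a0 ta mA indA _ _)) => [i|i|].
  + rewrite isotropic_dot ?x1 ?expr1n// => j.
    exact: (measurableT_comp (measurable_coord j) (mrow i)).
  + exact: exp2.
  rewrite lee_fin ler_expR; apply: ler_wpDr => //.
  by rewrite ler_wpM2l// ler_wpM2r ?sqr_ge0// /D lerDl divr_ge0// ltW.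
- apply: ric_tail => // x t x1 tD.
  have mcol j := @measurable_rand_col R _ Omega _ _ A j mA.
  have colK j : (psi2norm_vec P (rand_col A j) <= K%:E)%E.
    by rewrite -maxK; exact: le_bigmax.
  by apply: (column_model_mgf a0 aD) => // j u u1; exact: exp2.
Qed.
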